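(* For splittable Cu-VRPSD there is a randomized polynomial-time $(\alpha+1)$-approximation algorithm, where $\alpha$ is the approximation ratio of a polynomial-time algorithm for metric TSP.
   Context: Cu-VRPSD: an instance consists of a complete undirected graph on $\{v_0,v_1,\dots,v_n\}$ ($v_0$ the depot, $v_1,\dots,v_n$ customers), a metric edge weight $w$ (nonnegative, symmetric, triangle inequality), a vehicle capacity $Q>0$, parameters $a,b\ge0$, and independent random demands $\chi_1,\dots,\chi_n$ with values in $[0,Q]$ and distributions known in advance; the realized demand of $v_i$ is revealed only when the vehicle first visits $v_i$. A single vehicle starting at the depot performs tours (closed walks from $v_0$ back to $v_0$), loading goods at the depot, never carrying more than $Q$ units, delivering only to customers on the current tour, so that each customer receives exactly its demand in total; in the splittable variant a customer's demand may be delivered in parts over several visits. Traversing edge $uv$ while carrying $x$ units costs $a\,w(u,v)+b\,x\,w(u,v)$; the cumulative cost is the sum over all traversals (goods loaded but not delivered still count). A policy chooses the itinerary adaptively. A randomized $\rho$-approximation algorithm is a polynomial-time policy whose expected cumulative cost (over demands and internal randomness) is at most $\rho$ times the minimum expected cumulative cost over all policies. *)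

(* Defs.v *)
From HB Require Import structures.
From mathcomp Require Import all_boot all_order all_algebra all_fingroup.
From mathcomp Require Import all_classical all_reals all_analysis.

Set Implicit Arguments.
Unset Strict Implicit.
Unset Printing Implicit Defensive.

Import Order.TTheory GRing.Theory Num.Theory.
Import numFieldNormedType.Exports.

Local Open Scope classical_set_scope.
Local Open Scope ring_scope.

Definition metric (R : realType) (m : nat) (w : 'M[R]_m) : Prop :=
  [/\ forall i j, 0 <= w i j,
      forall i, w i i = 0,
      forall i j, w i j = w j i
    & forall i j k, w i k <= w i j + w j k].

(* The Hamiltonian cycle s 0, s 1, .., s k, s 0; ordS is the cyclic successor. *)
Definition tour_length (R : realType) (k : nat) (w : 'M[R]_k.+1)
    (s : 'S_k.+1) : R :=
  \sum_(i < k.+1) w (s i) (s (ordS i)).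

Definition tsp_opt (R : realType) (k : nat) (w : 'M[R]_k.+1) : R :=
  \big[Num.min/tour_length w 1%g]_(s : 'S_k.+1) tour_length w s.

Definition mutually_independent (R : realType) (disp : measure_display)
    (T : measurableType disp) (P : probability T R) (n : nat)
    (X : 'I_n -> {RV P >-> R}) : Prop :=
  forall (J : {set 'I_n}) (B : 'I_n -> set R),
    (forall i, measurable (B i)) ->
    P (\bigcap_(i in [set i | i \in J]) (X i @^-1` B i)) =
    (\big[*%E/1%E]_(i in J) P (X i @^-1` B i))%E.

(* The depot v_0 is ord0 : 'I_n.+1 and the customer v_(i+1), for i : 'I_n, is
   the vertex lift ord0 i. *)
Record instance (R : realType) : Type := Instance {
  ncust : nat;
  weight : 'M[R]_ncust.+1;
  capacity : R;
  cost_a : R;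
  cost_b : R;
  idisp : measure_display;
  sample : measurableType idisp;
  prob : probability sample R;
  demand : 'I_ncust -> {RV prob >-> R};
  weight_metric : metric weight;
  capacity_gt0 : 0 < capacity;
  cost_a_ge0 : 0 <= cost_a;
  cost_b_ge0 : 0 <= cost_b;
  demand_range : forall i t, 0 <= demand i t <= capacity;
  demand_indep : mutually_independent demand
}.

Arguments prob {R} I : rename.
Arguments demand {R} I i : rename.

(* SetLoad x makes the load equal to x, whatever was left on the vehicle. *)
Inductive action (R : realType) (n : nat) : Type :=
  | SetLoad of R
  | Go of 'I_n.+1
  | Deliver of R.

Notation itinerary R n := (seq (action R n)).

Section Problem.
Variable R : realType.
Variable I : instance R.
Notation n := (ncust I).

Record vehicle : Type := Vehicle {
  pos : 'I_n.+1;
  load : R;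
  delivered : 'I_n -> R
}.

Definition vehicle0 : vehicle := Vehicle ord0 0 (fun=> 0).

Definition legal (s : vehicle) (x : action R n) : bool :=
  match x with
  | SetLoad q => (pos s == ord0) && (0 <= q <= capacity I)
  | Go v => v != pos s
  | Deliver q => (pos s != ord0) && (0 <= q <= load s)
  end.

Definition move (s : vehicle) (x : action R n) : vehicle :=
  match x with
  | SetLoad q => Vehicle (pos s) q (delivered s)
  | Go v => Vehicle v (load s) (delivered s)
  | Deliver q =>
      Vehicle (pos s) (load s - q)
        (fun i => delivered s i + (if pos s == lift ord0 i then q else 0))
  end.

Definition action_cost (s : vehicle) (x : action R n) : R :=
  if x is Go v then
    cost_a I * weight I (pos s) v + cost_b I * load s * weight I (pos s) v
  else 0.

Fixpoint all_legal (s : vehicle) (h : itinerary R n) : bool :=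
  if h is x :: h' then legal s x && all_legal (move s x) h' else true.

Fixpoint cost_from (s : vehicle) (h : itinerary R n) : R :=
  if h is x :: h' then action_cost s x + cost_from (move s x) h' else 0.

Definition cumulative_cost (h : itinerary R n) : R := cost_from vehicle0 h.

Definition valid (d : 'I_n -> R) (h : itinerary R n) : Prop :=
  let s := foldl move vehicle0 h in
  [/\ all_legal vehicle0 h, pos s = ord0 & forall i, delivered s i = d i].

Definition visits (h : itinerary R n) (v : 'I_n.+1) : bool :=
  has (fun x => if x is Go u then u == v else false) h.

Definition revealed (d : 'I_n -> R) (h : itinerary R n) (i : 'I_n) : option R :=
  if visits h (lift ord0 i) then Some (d i) else None.

(* The next action (None to stop) as a function of the random seed, of the past
   actions and of the demands revealed so far. *)
Definition policy : Type :=
  R -> itinerary R n -> ('I_n -> option R) -> option (action R n).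

Definition follows (pi : policy) (u : R) (d : 'I_n -> R) (h : itinerary R n) :
    Prop :=
  (forall (h1 h2 : itinerary R n) (x : action R n), h = h1 ++ x :: h2 ->
     pi u h1 (revealed d h1) = Some x) /\
  pi u h (revealed d h) = None.

(* A demand vector is possible if each d i lies in the topological support of
   the law of the i-th demand; by independence these are the demand vectors
   that can occur. *)
Definition possible (d : 'I_n -> R) : Prop :=
  forall (i : 'I_n) (e : R), 0 < e ->
    (0 < prob I (demand I i @^-1` ball (d i) e))%E.

(* What a randomized adaptive rule does: the itinerary as a function of the
   seed and of the realized demands. *)
Definition outcome : Type := R -> ('I_n -> R) -> itinerary R n.

Definition realized_cost (H : outcome) (z : sample I * R) : R :=
  cumulative_cost (H z.2 (fun i => demand I i z.1)).

(* The seed is uniform on [0, 1] and independent of the demands. *)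
Definition expected_cost (H : outcome) : \bar R :=
  (\int[prob I \x uniform_prob (@ltr01 R)]_z (realized_cost H z)%:E)%E.

Definition policy_outcome (pi : policy) : outcome :=
  fun u d =>
    if pselect (exists h, follows pi u d h) is left hP then projT1 (cid hP)
    else [::].

Definition admissible (pi : policy) : Prop :=
  (forall (u : R) d, 0 <= u <= 1 -> possible d ->
     exists h, follows pi u d h /\ valid d h) /\
  measurable_fun [set: sample I * R] (realized_cost (policy_outcome pi)).

Definition opt_cost : \bar R :=
  ereal_inf [set expected_cost (policy_outcome pi) | pi in admissible].

End Problem.

(* Polynomial time is measured on a unit-cost real RAM. Memory cells are grouped
   into arrays named by naturals: one-dimensional arrays of naturals, used as
   indices, and two-dimensional arrays of reals. Reals support exact field
   operations and comparisons (no rounding), naturals only addition and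
   truncated subtraction. A program is finite and independent of the input
   size. *)

Inductive nexp : Type :=
  | NConst of nat
  | NGet of nat & nexp                 (* array name, index *)
  | NAdd of nexp & nexp
  | NSub of nexp & nexp.

Inductive rexp (R : Type) : Type :=
  | RConst of R
  | ROfNat of nexp
  | RGet of nat & nexp & nexp          (* array name, row, column *)
  | RAdd of rexp R & rexp R
  | RSub of rexp R & rexp R
  | RMul of rexp R & rexp R
  | RDiv of rexp R & rexp R.

Inductive bexp (R : Type) : Type :=
  | BLeN of nexp & nexp
  | BLeR of rexp R & rexp R
  | BNot of bexp R
  | BAnd of bexp R & bexp R.

Inductive com (R : Type) : Type :=
  | CSkip
  | CSeq of com R & com R
  | CIf of bexp R & com R & com R
  | CWhile of bexp R & com R
  | CSetN of nat & nexp & nexp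
  | CSetR of nat & nexp & nexp & rexp R
  (* CCdf x i j e r stores P(demand of vertex e <= r) in the real cell (x,i,j) *)
  | CCdf of nat & nexp & nexp & nexp & rexp R
  | CLoad of rexp R
  (* CGo x i j e drives to vertex e and stores its demand in the real cell
     (x,i,j) *)
  | CGo of nat & nexp & nexp & nexp
  | CDeliver of rexp R.

Fixpoint offline (R : Type) (c : com R) : bool :=
  match c with
  | CSeq c1 c2 | CIf _ c1 c2 => offline c1 && offline c2
  | CWhile _ c1 => offline c1
  | CSkip | CSetN _ _ _ | CSetR _ _ _ _ => true
  | CCdf _ _ _ _ _ | CLoad _ | CGo _ _ _ _ | CDeliver _ => false
  end.

Section Machine.
Variable R : realType.

Record memory : Type := Memory {
  nmem : nat -> nat -> nat;
  rmem : nat -> nat -> nat -> R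
}.

Fixpoint neval (m : memory) (e : nexp) : nat :=
  match e with
  | NConst k => k
  | NGet x i => nmem m x (neval m i)
  | NAdd e1 e2 => neval m e1 + neval m e2
  | NSub e1 e2 => neval m e1 - neval m e2
  end%N.

Fixpoint reval (m : memory) (e : rexp R) : R :=
  match e with
  | RConst r => r
  | ROfNat k => (neval m k)%:R
  | RGet x i j => rmem m x (neval m i) (neval m j)
  | RAdd e1 e2 => reval m e1 + reval m e2
  | RSub e1 e2 => reval m e1 - reval m e2
  | RMul e1 e2 => reval m e1 * reval m e2
  | RDiv e1 e2 => reval m e1 / reval m e2
  end.

Fixpoint beval (m : memory) (e : bexp R) : bool :=
  match e with
  | BLeN e1 e2 => (neval m e1 <= neval m e2)%N
  | BLeR e1 e2 => reval m e1 <= reval m e2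
  | BNot e1 => ~~ beval m e1
  | BAnd e1 e2 => beval m e1 && beval m e2
  end.

Definition setn (m : memory) (x i k : nat) : memory :=
  Memory (fun y i' => if (y == x) && (i' == i) then k else nmem m y i')
         (rmem m).

Definition setr (m : memory) (x i j : nat) (r : R) : memory :=
  Memory (nmem m)
    (fun y i' j' =>
       if [&& y == x, i' == i & j' == j] then r else rmem m y i' j').

Variable n : nat.

(* cdf i r = P(i-th demand <= r); dem i = realized i-th demand. *)
Variables (cdf : 'I_n -> R -> R) (dem : 'I_n -> R).

(* Pending commands, memory, actions emitted so far. *)
Definition config : Type := (seq (com R) * memory * itinerary R n)%type.

(* Extension of a customer-indexed family to the depot, with default value. *)
Definition at_vertex (A : Type) (x0 : A) (f : 'I_n -> A) (v : 'I_n.+1) : A :=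
  if unlift ord0 v is Some i then f i else x0.

(* Vertex numbers out of range are read as the depot, by inord. *)
Definition step (g : config) : config :=
  let: (cs, m, h) := g in
  if cs is c :: k then
    match c with
    | CSkip => (k, m, h)
    | CSeq c1 c2 => ([:: c1, c2 & k], m, h)
    | CIf b c1 c2 => ((if beval m b then c1 else c2) :: k, m, h)
    | CWhile b c1 => if beval m b then ([:: c1, c & k], m, h) else (k, m, h)
    | CSetN x i e => (k, setn m x (neval m i) (neval m e), h)
    | CSetR x i j e =>
        (k, setr m x (neval m i) (neval m j) (reval m e), h)
    | CCdf x i j e r =>
        let p := at_vertex 0 (cdf^~ (reval m r)) (inord (neval m e)) in
        (k, setr m x (neval m i) (neval m j) p, h)
    | CLoad e => (k, m, rcons h (SetLoad n (reval m e)))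
    | CGo x i j e =>
        let v := inord (neval m e) in
        (k, setr m x (neval m i) (neval m j) (at_vertex 0 dem v),
         rcons h (Go R v))
    | CDeliver e => (k, m, rcons h (Deliver n (reval m e)))
    end
  else g.

Definition run (t : nat) (c : com R) (m : memory) : config :=
  iter t step ([:: c], m, [::]).

Definition halted (g : config) : bool := nilp g.1.1.

End Machine.

(* The size of an input is its number of vertices, which is polynomially related
   to the number of reals it consists of. *)

Section Algorithms.
Variable R : realType.

(* Natural array 0: the number k.+1 of vertices. Real array 0: the weights. *)
Definition tsp_nmem (k : nat) (x i : nat) : nat :=
  if (x == 0%N) && (i == 0%N) then k.+1 else 0%N.

Definition weight_array (k : nat) (w : 'M[R]_k.+1) (i j : nat) : R :=
  if (i <= k)%N && (j <= k)%N then w (inord i) (inord j) else 0.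

Definition tsp_input (k : nat) (w : 'M[R]_k.+1) : memory R :=
  Memory (tsp_nmem k) (fun x => if x == 0%N then weight_array w else fun _ _ => 0).

(* The tour is output in natural array 1. *)
Definition tsp_approximation (alpha : R) (c : com R) : Prop :=
  offline c /\
  exists p : {poly nat}, forall (k : nat) (w : 'M[R]_k.+1), metric w ->
    let g := run (n := k) (fun _ _ => 0) (fun=> 0) p.[k.+1] c (tsp_input w) in
    halted g /\
    exists s : 'S_k.+1,
      (forall i : 'I_k.+1, nmem g.1.2 1 i = s i) /\
      tour_length w s <= alpha * tsp_opt w.

(* As for TSP, together with row 0 of real array 1: capacity, a, b and seed. *)
Definition vrp_input (I : instance R) (u : R) : memory R :=
  Memory (tsp_nmem (ncust I))
    (fun x i j =>
       match x with
       | 0 => weight_array (weight I) i j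
       | 1 => if i == 0%N then [:: capacity I; cost_a I; cost_b I; u]`_j else 0
       | _ => 0
       end).

Definition vrp_run (c : com R) (t : nat) (I : instance R) (u : R)
    (d : 'I_(ncust I) -> R) : config R (ncust I) :=
  run (fun i r => fine (cdf (demand I i) r)) d t c (vrp_input I u).

Definition vrp_outcome (c : com R) (t : nat) (I : instance R) : outcome I :=
  fun u d => (vrp_run c t u d).2.

Definition cuvrpsd_approximation (rho : R) (c : com R) : Prop :=
  exists p : {poly nat}, forall I : instance R,
    let t := p.[(ncust I).+1] in
    [/\ forall (u : R) (d : 'I_(ncust I) -> R), 0 <= u <= 1 -> possible d ->
          halted (vrp_run c t u d) /\ valid d (vrp_outcome c t u d),
        measurable_fun [set: sample I * R]
          (realized_cost (vrp_outcome c t (I := I)))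
      & (expected_cost (vrp_outcome c t (I := I)) <= rho%:E * opt_cost I)%E].

End Algorithms.

(* Main.v *)
(* Call a customer essential if its demand is nonzero with positive probability;
   moving the other customers to the depot gives a pseudometric w', on which the
   TSP algorithm finds a tour of length at most alpha T, T the optimum. Drive
   along it with initial load U q, U uniform on [0, 1]; whenever the demand d of
   a customer exceeds the load, deliver the load, refill max(q, d) at the depot
   and come back. For fixed demands the loads are rotations of the circle of
   length q, so each has mean q / 2, and the refill trip to a customer at distance
   l of the depot costs on average at most (kappa + b) l d if kappa q >= 2 a.
   With S the sum of the l d, the expected cost is at most
   (a + b q / 2) alpha T + (kappa + b) E S.
   Conversely, two potential functions show that an itinerary has length at least
   2 S / Q and carries its load over at least S, and an admissible policy visits
   every essential customer, since it would act alike had the demand been nonzero.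
   So every policy costs at least a T + b E S and (2 a / Q + b) E S, and
   q = min(Q, 2 a / (b alpha)) makes the upper bound at most alpha + 1 times the
   larger of the two. *)
Require Import Defs.
From mathcomp Require Import all_boot all_order all_algebra all_fingroup.
From mathcomp Require Import all_classical all_reals all_analysis.
From mathcomp Require Import measurable_realfun.
From mathcomp Require Import zify ring lra.

Set Implicit Arguments.
Unset Strict Implicit.
Unset Printing Implicit Defensive.

Import Order.TTheory GRing.Theory Num.Theory.
Import numFieldNormedType.Exports.

Local Open Scope classical_set_scope.
Local Open Scope ring_scope.

(** * Time-bounded Hoare triples for the machine *)

Section Triples.
Variables (R : realType) (n : nat).
Variables (cdf : 'I_n -> R -> R) (dem : 'I_n -> R).
Implicit Types (m : memory R) (h : itinerary R n) (c : com R) (b : bexp R).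
Implicit Types (post : memory R -> itinerary R n -> Prop).

(** The step count and the final state are the same for every stack [k] of pending commands, which
    is what makes triples compose; [T] only bounds the count because branches take different
    times. *)
Definition triple (T : nat) c m h post : Prop :=
  exists t m' h', [/\ (t <= T)%N,
    forall k, iter t (step cdf dem) (c :: k, m, h) = (k, m', h')
    & post m' h'].

Lemma triple_weaken T T' c m h post post' :
  triple T c m h post -> (T <= T')%N ->
  (forall m' h', post m' h' -> post' m' h') -> triple T' c m h post'.
Proof.
move=> [t [m' [h' [tT ct pt]]]] TT' pp.
by exists t, m', h'; split=> //; [exact: leq_trans TT' | exact: pp].
Qed.

Lemma triple_post T c m h post post' : triple T c m h post ->
  (forall m' h', post m' h' -> post' m' h') -> triple T c m h post'.
Proof. by move=> /triple_weaken; apply. Qed.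

Lemma triple_skip m h post : post m h -> triple 1 (@CSkip R) m h post.
Proof. by move=> p; exists 1%N, m, h. Qed.

Lemma triple_setn m h post x i e : post (setn m x (neval m i) (neval m e)) h ->
  triple 1 (CSetN R x i e) m h post.
Proof. by move=> p; exists 1%N, (setn m x (neval m i) (neval m e)), h. Qed.

Lemma triple_setr m h post x i j e :
  post (setr m x (neval m i) (neval m j) (reval m e)) h ->
  triple 1 (CSetR x i j e) m h post.
Proof.
by move=> p; exists 1%N, (setr m x (neval m i) (neval m j) (reval m e)), h.
Qed.

Lemma triple_cdf m h post x i j e r :
  post (setr m x (neval m i) (neval m j)
          (at_vertex 0 (cdf^~ (reval m r)) (inord (neval m e)))) h ->
  triple 1 (CCdf x i j e r) m h post.
Proof.
move=> p; exists 1%N, (setr m x (neval m i) (neval m j)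
          (at_vertex 0 (cdf^~ (reval m r)) (inord (neval m e)))), h.
by split.
Qed.

Lemma triple_load m h post e : post m (rcons h (SetLoad n (reval m e))) ->
  triple 1 (CLoad e) m h post.
Proof. by move=> p; exists 1%N, m, (rcons h (SetLoad n (reval m e))). Qed.

Lemma triple_deliver m h post e : post m (rcons h (Deliver n (reval m e))) ->
  triple 1 (CDeliver e) m h post.
Proof. by move=> p; exists 1%N, m, (rcons h (Deliver n (reval m e))). Qed.

Lemma triple_go m h post x i j e :
  post (setr m x (neval m i) (neval m j) (at_vertex 0 dem (inord (neval m e))))
       (rcons h (Go R (inord (neval m e)))) ->
  triple 1 (CGo R x i j e) m h post.
Proof.
move=> p; exists 1%N, (setr m x (neval m i) (neval m j)
  (at_vertex 0 dem (inord (neval m e)))), (rcons h (Go R (inord (neval m e)))).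
by split.
Qed.

Lemma triple_seq T1 T2 c1 c2 m h post :
  triple T1 c1 m h (fun m' h' => triple T2 c2 m' h' post) ->
  triple (T1 + T2).+1 (CSeq c1 c2) m h post.
Proof.
move=> [t1 [m1 [h1 [tT1 r1 [t2 [m2 [h2 [tT2 r2 p2]]]]]]]].
exists (t2 + t1).+1, m2, h2; split=> //; first by rewrite ltnS addnC leq_add.
by move=> k; rewrite iterSr /= iterD r1 r2.
Qed.

Lemma triple_if T b c1 c2 m h post :
  triple T (if beval m b then c1 else c2) m h post ->
  triple T.+1 (CIf b c1 c2) m h post.
Proof.
move=> [t [m' [h' [tT r p]]]]; exists t.+1, m', h'; split=> // k.
by rewrite iterSr /= r.
Qed.

(** The index of [Inv] is the number of iterations left, so it serves at once as termination measure
    and as iteration count. Each iteration pays one step for its test, and the failing test costs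
    one more. *)
Lemma triple_while T b c (Inv : nat -> memory R -> itinerary R n -> Prop) K m h :
  (forall k m h, Inv k m h -> beval m b = (0 < k)%N) ->
  (forall k m h, Inv k.+1 m h -> triple T c m h (Inv k)) ->
  Inv K m h -> triple (K * T.+1).+1 (CWhile b c) m h (Inv 0%N).
Proof.
move=> Ib Ic; elim: K m h => [|K IH] m h IK.
  by exists 1%N, m, h; split=> // k /=; rewrite (Ib _ _ _ IK).
have [t1 [m1 [h1 [tT1 r1 p1]]]] := Ic _ _ _ IK.
have [t2 [m2 [h2 [tT2 r2 p2]]]] := IH _ _ p1.
exists (t2 + t1).+1, m2, h2; split=> //.
  by rewrite mulSn ltnS addnC; lia.
by move=> k; rewrite iterSr /= (Ib _ _ _ IK) /= iterD r1 r2.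
Qed.

(** A halted configuration is a fixed point of [step], so the steps of [T] that are left over do
    nothing. *)
Lemma triple_run T c m post : triple T c m [::] post ->
  let g := run cdf dem T c m in halted g /\ post g.1.2 g.2.
Proof.
move=> [t [m' [h' [tT r p]]]] /=; rewrite /run.
have -> : iter T (step cdf dem) ([:: c], m, [::]) = ([::], m', h').
  rewrite -(subnK tT) iterD r; elim: (T - t)%N => //= s -> //.
by [].
Qed.

End Triples.

(** * Running an offline program on renamed arrays *)

Fixpoint shiftn (K : nat) (e : nexp) : nexp :=
  match e with
  | NConst k => NConst k
  | NGet x i => NGet (x + K) (shiftn K i)
  | NAdd e1 e2 => NAdd (shiftn K e1) (shiftn K e2)
  | NSub e1 e2 => NSub (shiftn K e1) (shiftn K e2)
  end.

Fixpoint shiftr (T : Type) (K : nat) (e : rexp T) : rexp T :=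
  match e with
  | RConst r => RConst r
  | ROfNat k => ROfNat T (shiftn K k)
  | RGet x i j => RGet T (x + K) (shiftn K i) (shiftn K j)
  | RAdd e1 e2 => RAdd (shiftr K e1) (shiftr K e2)
  | RSub e1 e2 => RSub (shiftr K e1) (shiftr K e2)
  | RMul e1 e2 => RMul (shiftr K e1) (shiftr K e2)
  | RDiv e1 e2 => RDiv (shiftr K e1) (shiftr K e2)
  end.

Fixpoint shiftb (T : Type) (K : nat) (b : bexp T) : bexp T :=
  match b with
  | BLeN e1 e2 => BLeN T (shiftn K e1) (shiftn K e2)
  | BLeR e1 e2 => BLeR (shiftr K e1) (shiftr K e2)
  | BNot e1 => BNot (shiftb K e1)
  | BAnd e1 e2 => BAnd (shiftb K e1) (shiftb K e2)
  end.

(* Only offline commands are renamed, so the vehicle commands can be dropped. *)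
Fixpoint shiftc (T : Type) (K : nat) (c : com T) : com T :=
  match c with
  | CSeq c1 c2 => CSeq (shiftc K c1) (shiftc K c2)
  | CIf b c1 c2 => CIf (shiftb K b) (shiftc K c1) (shiftc K c2)
  | CWhile b c1 => CWhile (shiftb K b) (shiftc K c1)
  | CSetN x i e => CSetN T (x + K) (shiftn K i) (shiftn K e)
  | CSetR x i j e => CSetR (x + K) (shiftn K i) (shiftn K j) (shiftr K e)
  | _ => CSkip T
  end.

Section Shift.
Variables (R : realType) (n : nat) (K : nat).
Variables (cdf : 'I_n -> R -> R) (dem : 'I_n -> R).
Implicit Types (m M : memory R) (c : com R).

(** [m] is the memory as the offline program sees it, [M] the actual one, in which the arrays with
    names below [K] belong to the caller. *)
Definition embeds m M : Prop :=
  (forall x i, nmem m x i = nmem M (x + K) i) /\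
  (forall x i j, rmem m x i j = rmem M (x + K) i j).

Definition same_below M M' : Prop :=
  (forall x i, (x < K)%N -> nmem M' x i = nmem M x i) /\
  (forall x i j, (x < K)%N -> rmem M' x i j = rmem M x i j).

Lemma same_below_trans M1 M2 M3 :
  same_below M1 M2 -> same_below M2 M3 -> same_below M1 M3.
Proof.
by move=> [a1 b1] [a2 b2]; split=> *; rewrite ?a2 ?b2 ?a1 ?b1.
Qed.

Lemma neval_shift m M e : embeds m M -> neval M (shiftn K e) = neval m e.
Proof.
by move=> [en _]; elim: e => //= [x i ->|e1 -> e2 ->|e1 -> e2 ->]; rewrite ?en.
Qed.

Lemma reval_shift m M e : embeds m M -> reval M (shiftr K e) = reval m e.
Proof.
move=> mM; have [_ er] := mM.
by elim: e => //= [k|x i j|e1 -> e2 ->|e1 -> e2 ->|e1 -> e2 ->|e1 -> e2 ->] //;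
  rewrite !(neval_shift _ mM) ?er.
Qed.

Lemma beval_shift m M e : embeds m M -> beval M (shiftb K e) = beval m e.
Proof.
move=> mM; elim: e => //= [e1 e2|e1 e2|e1 ->|e1 -> e2 ->] //.
  by rewrite !(neval_shift _ mM).
by rewrite !(reval_shift _ mM).
Qed.

Lemma embeds_setn m M x i k :
  embeds m M -> embeds (setn m x i k) (setn M (x + K) i k).
Proof. by move=> [a b]; split=> //= *; rewrite eqn_add2r a. Qed.

Lemma embeds_setr m M x i j r :
  embeds m M -> embeds (setr m x i j r) (setr M (x + K) i j r).
Proof. by move=> [a b]; split=> //= *; rewrite eqn_add2r b. Qed.

Lemma same_below_setn M x i k : same_below M (setn M (x + K) i k).
Proof. by split=> //= y j yK; case: eqP => // yx; exfalso; lia. Qed.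

Lemma same_below_setr M x i j r : same_below M (setr M (x + K) i j r).
Proof. by split=> //= y j' k yK; case: eqP => // yx; exfalso; lia. Qed.

Variables (n' : nat) (cdf' : 'I_n' -> R -> R) (dem' : 'I_n' -> R).

(** Step-by-step simulation. The two machines may have different customers, distributions and
    demands, because offline commands consult none of them; [h] stays as it is since they emit no
    action. *)
Lemma iter_shift t cs m M (h : itinerary R n) m' h' :
  all (@offline R) cs -> embeds m M ->
  iter t (step cdf' dem') (cs, m, [::]) = ([::], m', h') ->
  exists t' M', [/\ (t' <= t)%N, embeds m' M', same_below M M' &
    forall k, iter t' (step cdf dem) (map (shiftc K) cs ++ k, M, h) = (k, M', h)].
Proof.
have refl M0 : same_below M0 M0 by split.
elim: t cs m M => [|t IH] cs m M.
  by move=> _ mM [-> <- _]; exists 0%N, M; split.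
case: cs => [|c cs].
  have -> s : iter s (step cdf' dem') ([::], m, [::]) = ([::], m, [::]).
    by elim: s => //= s ->.
  by move=> _ mM [<- _]; exists 0%N, M; split.
rewrite iterSr => /= /andP[oc ocs] mM.
(* Each command only has to exhibit the configurations after one step on both sides; the induction
   hypothesis does the rest. *)
suff H cs1 m1 M1 : all (@offline R) cs1 -> embeds m1 M1 -> same_below M M1 ->
   (forall k, step cdf dem (shiftc K c :: map (shiftc K) cs ++ k, M, h) =
     (map (shiftc K) cs1 ++ k, M1, h)) ->
   iter t (step cdf' dem') (cs1, m1, [::]) = ([::], m', h') ->
   exists t' M', [/\ (t' <= t.+1)%N, embeds m' M', same_below M M' &
    forall k, iter t' (step cdf dem)
      (shiftc K c :: map (shiftc K) cs ++ k, M, h) = (k, M', h)].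
  case: c oc H => //=.
  - by move=> _ H; apply: (H cs m M).
  - by move=> c1 c2 /andP[oc1 oc2] H; apply: (H [:: c1, c2 & cs] m M) => //=; rewrite oc1 oc2.
  - move=> b c1 c2 /andP[oc1 oc2] H.
    apply: (H ((if beval m b then c1 else c2) :: cs) m M) => //=.
      by case: (beval m b); rewrite ?oc1 ?oc2.
    by move=> k; rewrite (beval_shift _ mM); case: (beval m b).
  - move=> b c1 o1 H; case bE: (beval m b).
      apply: (H [:: c1, CWhile b c1 & cs] m M) => //=; rewrite ?o1 //.
      by move=> k; rewrite (beval_shift _ mM) bE.
    by apply: (H cs m M) => //= k; rewrite (beval_shift _ mM) bE.
  - move=> x i e _ H; apply: (H cs _ (setn M (x + K) (neval m i) (neval m e))) => //;
      [exact: embeds_setn mM|exact: same_below_setn|]; by move=> k; rewrite !(neval_shift _ mM).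
  - move=> x i j e _ H; 
    apply: (H cs _ (setr M (x + K) (neval m i) (neval m j) (reval m e))) => //;
      [exact: embeds_setr mM|exact: same_below_setr|];
      by move=> k; rewrite !(neval_shift _ mM) (reval_shift _ mM).
move=> o1 e1 s1 st1 r1; have [t' [M' [tt e' s' r']]] := IH _ _ _ o1 e1 r1.
exists t'.+1, M'; split=> //; first exact: same_below_trans s1 s'.
by move=> k; rewrite iterSr st1 r'.
Qed.

Lemma triple_shift T c m M (h : itinerary R n) :
  offline c -> embeds m M -> halted (run cdf' dem' T c m) ->
  triple cdf dem T (shiftc K c) M h (fun M' h' =>
    [/\ embeds (run cdf' dem' T c m).1.2 M', same_below M M' & h' = h]).
Proof.
move=> oc mM; rewrite /run.
case E : (iter _ _ _) => [[cs m'] h'] /nilP /= cs0; rewrite {}cs0 in E *.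
have oc' : all (@offline R) [:: c] by rewrite /= oc.
have [t' [M' [tt e' s' r']]] := iter_shift h oc' mM E.
by exists t', M', h; split.
Qed.

End Shift.

(** * Walks, tours and shortcuts *)

Fixpoint pathlen (R : realType) (m : nat) (w : 'M[R]_m) (x : 'I_m)
    (s : seq 'I_m) : R :=
  if s is y :: s' then w x y + pathlen w y s' else 0.

Section Paths.
Variables (R : realType) (k : nat) (w : 'M[R]_k.+1).
Hypothesis wM : metric w.
Implicit Types (x y : 'I_k.+1) (s : seq 'I_k.+1).

Lemma pathlen_cat x s1 s2 :
  pathlen w x (s1 ++ s2) = pathlen w x s1 + pathlen w (last x s1) s2.
Proof. by elim: s1 x => [|y s IH] x /=; rewrite ?add0r // IH addrA. Qed.

Lemma pathlen_ge0 x s : 0 <= pathlen w x s.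
Proof.
have [w0 _ _ _] := wM.
by elim: s x => //= y s IH x; rewrite addr_ge0.
Qed.

Lemma pathlen_detour x y s : pathlen w x s <= w x y + pathlen w y s.
Proof.
have [w0 _ _ wT] := wM; case: s => [|z s] /=; first by rewrite addr0.
by rewrite addrA lerD2r.
Qed.

(** Shortcutting: by the triangle inequality each vertex left out was a detour. *)
Lemma pathlen_subseq x s1 s2 : subseq s1 s2 -> pathlen w x s1 <= pathlen w x s2.
Proof.
elim: s2 x s1 => [|b s2 IH] x [|a s1] //; first by rewrite pathlen_ge0.
rewrite [subseq _ _]/=; case: eqP => [->|_] sub; first by rewrite lerD2l IH.
by apply: (le_trans (pathlen_detour x b _)); rewrite lerD2l IH.
Qed.

Lemma pathlen_nseq x m : pathlen w x (nseq m x) = 0.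
Proof.
by have [_ w0 _ _] := wM; elim: m => //= m ->; rewrite w0 addr0.
Qed.

End Paths.

Section Tours.
Variables (R : realType) (k : nat).
Implicit Types (w : 'M[R]_k.+1) (s : 'S_k.+1).

Lemma pathlen_map_iota w (f : nat -> 'I_k.+1) i0 m :
  pathlen w (f i0) [seq f i | i <- iota i0.+1 m] =
  \sum_(i < m) w (f (i0 + i)%N) (f (i0 + i).+1).
Proof.
elim: m i0 => [|m IH] i0; first by rewrite big_ord0.
rewrite big_ord_recl /= IH addn0; congr (_ + _).
by apply: eq_bigr => i _; rewrite /bump /= add1n addnS addSn.
Qed.

Definition tour_from s (j0 : 'I_k.+1) (i : nat) : 'I_k.+1 :=
  s (inord ((j0 + i) %% k.+1)).

Lemma tour_length_rot w s j0 :
  tour_length w s =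
  pathlen w (s j0) [seq tour_from s j0 i | i <- iota 1 k.+1].
Proof.
have -> : s j0 = tour_from s j0 0.
  by rewrite /tour_from addn0 modn_small ?inord_val.
rewrite pathlen_map_iota /tour_length (reindex_inj (addrI j0)) /=.
apply: eq_bigr => i _; rewrite /tour_from add0n.
congr (w (s _) (s _)); apply: val_inj => /=; rewrite inordK ?ltn_mod //.
by rewrite addnS -addn1 modnDml addn1.
Qed.

Lemma tour_from_all s j0 : tour_from s j0 k.+1 = s j0.
Proof. by rewrite /tour_from modnDr modn_small ?inord_val. Qed.

Lemma tour_from_inj s j0 : {in iota 1 k &, injective (tour_from s j0)}.
Proof.
move=> a b; rewrite !mem_iota => ha hb /perm_inj /(congr1 val) /=.
rewrite !inordK ?ltn_mod // => /eqP; rewrite eqn_modDl !modn_small; last 2 first.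
- by lia.
- by lia.
by move/eqP.
Qed.

Lemma tour_from_neq s j0 a : a \in iota 1 k -> tour_from s j0 a != s j0.
Proof.
rewrite mem_iota => ha; apply/eqP => /perm_inj /(congr1 val) /=.
rewrite inordK ?ltn_mod // => E.
have /eqP : (j0 + a = j0 + 0 %[mod k.+1])%N by rewrite E addn0 modn_small.
by rewrite eqn_modDl mod0n modn_small ?lt0n_neq0 //; lia.
Qed.

Lemma tsp_opt_le w s : tsp_opt w <= tour_length w s.
Proof. by apply: bigmin_le_cond. Qed.

Lemma tsp_opt_ge w (x : R) :
  (forall s, x <= tour_length w s) -> x <= tsp_opt w.
Proof. by move=> xw; apply: le_bigmin => // s _; exact: xw. Qed.

Lemma tsp_opt_ge0 w : metric w -> 0 <= tsp_opt w.
Proof.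
by move=> wM; apply: tsp_opt_ge => s; rewrite (tour_length_rot w s ord0) pathlen_ge0.
Qed.

End Tours.

(* Vertices outside ess are moved to the depot: a tour of the resulting
   pseudometric is a tour of the depot and the vertices of ess. *)
Section Collapse.
Variables (R : realType) (k : nat) (w : 'M[R]_k.+1) (ess : pred 'I_k.+1).
Hypothesis wM : metric w.
Hypothesis ess0 : ess ord0 = false.

Definition collapse (v : 'I_k.+1) : 'I_k.+1 := if ess v then v else ord0.

Definition collapsed : 'M[R]_k.+1 := \matrix_(i, j) w (collapse i) (collapse j).

Lemma collapsed_metric : metric collapsed.
Proof.
have [w0 wI wS wT] := wM.
by split=> [i j|i|i j|i j l]; rewrite !mxE // wS.
Qed.

Lemma pathlen_collapsed x s :
  pathlen collapsed x s = pathlen w (collapse x) (map collapse s).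
Proof. by elim: s x => //= y s IH x; rewrite mxE IH. Qed.

Lemma filter_collapse s : [seq v <- map collapse s | ess v] = [seq v <- s | ess v].
Proof.
elim: s => //= x s IH; rewrite {1 2}/collapse.
by case: (boolP (ess x)) => ex; rewrite ?ex ?ess0 IH.
Qed.

(** In [w] the collapsed tour passes through the vertices of [ess] in tour order, with stops at the
    depot in between; leaving these stops out is a shortcut. *)
Lemma filter_tour_le (s : 'S_k.+1) j0 : s j0 = ord0 ->
  pathlen w ord0
    (rcons (seq.filter ess [seq tour_from s j0 i | i <- iota 1 k]) ord0) <=
  tour_length collapsed s.
Proof.
move=> s0; rewrite (tour_length_rot _ _ j0) s0.
have -> : iota 1 k.+1 = iota 1 k ++ iota (1 + k) 1 by rewrite -iotaD addn1.
rewrite map_cat.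
have -> : [seq tour_from s j0 i | i <- iota (1 + k) 1] = [:: ord0].
  by rewrite /= add1n tour_from_all s0.
rewrite pathlen_collapsed map_cat /=.
have -> : collapse ord0 = ord0 by rewrite /collapse ess0.
rewrite -cats1; apply: pathlen_subseq => //; apply: cat_subseq => //.
by rewrite -filter_collapse; exact: filter_subseq.
Qed.

(** List the vertices of [ess] once each, as a subsequence of the walk, followed by all the others,
    which collapse to the depot and add no length. The resulting tour of the pseudometric is a
    shortcut of the walk. *)
Lemma tsp_opt_le_closed_walk (vs : seq 'I_k.+1) :
  last ord0 vs = ord0 -> (forall v, ess v -> v \in vs) ->
  tsp_opt collapsed <= pathlen w ord0 vs.
Proof.
move=> lvs evs.
pose E := undup (seq.filter ess vs).
pose N := seq.filter (fun v => (v != ord0) && ~~ ess v) (enum 'I_k.+1).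
pose t := ord0 :: E ++ N.
have memE v : (v \in E) = ess v.
  by rewrite mem_undup mem_filter; case: (boolP (ess v)) => //= /evs ->.
have memN v : (v \in N) = (v != ord0) && ~~ ess v.
  by rewrite mem_filter mem_enum andbT.
have ut : uniq t.
  rewrite /= mem_cat memE memN ess0 /= cat_uniq undup_uniq filter_uniq ?enum_uniq //.
  rewrite !andbT; apply/hasPn => v; rewrite memE memN.
  by case/andP.
have st : size t = k.+1.
  have /card_uniqP <- := ut; rewrite -[RHS]card_ord; apply: eq_card => v.
  by rewrite !inE mem_cat memE memN; case: eqP => //=; case: (ess v).
have ft : injective (fun i : 'I_k.+1 => nth ord0 t i).
  by move=> i j /eqP; rewrite nth_uniq ?st // => /eqP /val_inj.
pose s : 'S_k.+1 := perm ft.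
apply: (le_trans (tsp_opt_le _ s)); rewrite (tour_length_rot _ _ ord0).
have -> : s ord0 = ord0 by rewrite permE.
have -> : [seq tour_from s ord0 i | i <- iota 1 k.+1] = rcons (E ++ N) ord0.
  apply: (@eq_from_nth _ ord0).
    by rewrite size_map size_iota size_rcons; exact: esym st.
  move=> i; rewrite size_map size_iota => ik.
  rewrite (nth_map 0%N) ?size_iota // nth_iota // add1n.
  have sE : size (E ++ N) = k by case: st.
  rewrite nth_rcons sE; case: ltnP => ik'.
    by rewrite /tour_from permE inordK ?ltn_mod // add0n modn_small.
  have -> : i = k by lia.
  by rewrite eqxx tour_from_all permE.
rewrite pathlen_collapsed.
have c0 : collapse ord0 = ord0 by rewrite /collapse ess0.
rewrite c0 map_rcons c0 map_cat.
have -> : map collapse E = E.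
  by apply: map_id_in => v; rewrite memE /collapse => ->.
have -> : map collapse N = nseq (size N) ord0.
  apply: (@eq_from_nth _ ord0); first by rewrite size_map size_nseq.
  move=> i; rewrite size_map => iN; rewrite nth_nseq iN (nth_map ord0) //.
  by have := mem_nth ord0 iN; rewrite memN /collapse; case: (ess _) => //; rewrite andbF.
have -> : pathlen w ord0 (rcons (E ++ nseq (size N) ord0) ord0) =
          pathlen w ord0 (rcons E ord0).
  have nS m : rcons (nseq m (ord0 : 'I_k.+1)) ord0 = nseq m.+1 ord0.
    by elim: m => //= m ->.
  rewrite rcons_cat nS pathlen_cat /= pathlen_nseq // addr0 -cats1.
  by rewrite pathlen_cat /= addr0.
case/lastP: vs lvs @E {evs t memE ut st ft s} => [_|vs v].
  by have [_ w0 _ _] := wM; rewrite /= w0 addr0.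
rewrite last_rcons => ->; rewrite filter_rcons ess0 => /=.
apply: pathlen_subseq => //; rewrite -!cats1; apply: cat_subseq => //.
by apply: subseq_trans (undup_subseq _) (filter_subseq _ _).
Qed.

End Collapse.

(** Two vertices at distance 1 have only tours of length 2, so the guarantee reads 2 <= 2 alpha
    there. *)
Lemma tsp_approximation_ge1 (R : realType) (alpha : R) (c : com R) :
  tsp_approximation alpha c -> 1 <= alpha.
Proof.
move=> [_ [p /(_ 1%N (\matrix_(i, j) (i != j)%:R))]].
set w := \matrix_(i, j) _ => H.
have wM : metric w.
  split=> [i j|i|i j|i j l]; rewrite !mxE ?eqxx //; first by rewrite eq_sym.
  rewrite -natrD ler_nat; case: (eqVneq i j) => [->|] //=.
  by case: (i != l) => //=; rewrite ?leq_addr.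
have E s : tour_length w s = 2.
  rewrite /tour_length (eq_bigr (fun=> 1)); first by rewrite sumr_const card_ord.
  move=> i _; rewrite mxE (_ : _ != _) //; apply/eqP => /perm_inj /(congr1 val) /=.
  by case: i => [[|[|]]].
have opt2 : tsp_opt w = 2.
  apply/eqP; rewrite eq_le -{1}(E 1%g) tsp_opt_le /=.
  by apply: tsp_opt_ge => s; rewrite E.
have [_ [s [_]]] := H wM; rewrite E opt2.
lra.
Qed.

(** * Lower bounds on the cost of a valid itinerary *)

Section LowerBounds.
Variables (R : realType) (I : instance R).
Notation n := (ncust I).
Notation w := (weight I).
Notation Q := (capacity I).
Implicit Types (s : vehicle I) (x : Defs.action R n) (h : itinerary R n).

Fixpoint walk h : seq 'I_n.+1 :=
  match h with
  | Go v :: h' => v :: walk h'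
  | _ :: h' => walk h'
  | [::] => [::]
  end.

Fixpoint load_length s h : R :=
  if h is x :: h' then
    (if x is Go v then load s * w (pos s) v else 0) + load_length (move s x) h'
  else 0.

(** Applied to the demands this is the sum S; applied to [delivered s] it is the part of both
    potentials that records progress. *)
Definition service (d : 'I_n -> R) : R := \sum_i w ord0 (lift ord0 i) * d i.

(** Separates driving from carrying, so that each can be bounded by its own potential. *)
Lemma cost_fromE s h :
  cost_from s h = cost_a I * pathlen w (pos s) (walk h) +
                  cost_b I * load_length s h.
Proof.
elim: h s => [|x h IH] s /=; first by rewrite !mulr0 addr0.
rewrite IH; case: x => [y|v|y] /=; rewrite ?add0r //.
by ring.
Qed.

Lemma pos_foldl s h : pos (foldl (@move R I) s h) = last (pos s) (walk h).
Proof. by elim: h s => [|[y|v|y] h IH] s //=; rewrite IH. Qed.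

Lemma mem_walk h v : (v \in walk h) = visits h v.
Proof.
elim: h => [|[y|u|y] h IH] //=; rewrite inE IH; congr (_ || _).
by rewrite eq_sym.
Qed.

Lemma delivered_unvisited s h i : pos s != lift ord0 i ->
  ~~ visits h (lift ord0 i) -> delivered (foldl (@move R I) s h) i = delivered s i.
Proof.
elim: h s => [|[y|v|y] h IH] s //= pi; first exact: IH.
  by rewrite negb_or => /andP[vi hi]; rewrite IH.
by move=> hi; rewrite IH //= (negbTE pi) addr0.
Qed.

Lemma service_deliver s y : pos s != ord0 ->
  service (delivered (move s (Deliver n y))) =
  service (delivered s) + w ord0 (pos s) * y.
Proof.
rewrite eq_sym => /unlift_some[j pj _]; rewrite /service /= pj.
under eq_bigr do rewrite mulrDr.
rewrite big_split /=; congr (_ + _).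
rewrite (bigD1 j) //= eqxx big1 ?addr0 // => i ij.
by rewrite (inj_eq lift_inj) eq_sym (negbTE ij) mulr0.
Qed.

Lemma load_move s x : legal s x -> 0 <= load s <= Q -> 0 <= load (move s x) <= Q.
Proof.
by case: x => [y|v|y] //= /andP[_ /andP[y0 yl]] /andP[l0 lQ]; rewrite ?y0 ?yl //; lra.
Qed.

(* The load times the distance to the depot, plus the service delivered so far,
   grows no faster than the load travels. *)
Lemma load_length_ge s h : all_legal s h -> 0 <= load s <= Q ->
  let f := foldl (@move R I) s h in
  load f * w ord0 (pos f) + service (delivered f) <=
  load s * w ord0 (pos s) + service (delivered s) + load_length s h.
Proof.
have [w0 wI wS wT] := weight_metric I.
elim: h s => [|x h IH] s /=; first by rewrite addr0.
move=> /andP[lx lh] ls; apply: (le_trans (IH _ lh (load_move lx ls))).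
case: x lx lh => [y|v|y].
- by move=> /= /andP[/eqP -> _] _; rewrite wI !mulr0 !add0r.
- move=> /= _ _; have := wT ord0 (pos s) v.
  have /andP[l0 _] := ls.
  move=> /(ler_wpM2l l0); rewrite mulrDr; lra.
- move=> /[dup] /andP[p0 _] _ _; rewrite service_deliver //= add0r.
  lra.
Qed.

(* Potential argument: |2 load / Q - 1| <= 1. *)
Lemma pathlen_walk_ge s h : all_legal s h -> 0 <= load s <= Q ->
  let f := foldl (@move R I) s h in
  (2 * load f / Q - 1) * w ord0 (pos f) + 2 / Q * service (delivered f) <=
  (2 * load s / Q - 1) * w ord0 (pos s) + 2 / Q * service (delivered s) +
  pathlen w (pos s) (walk h).
Proof.
have [w0 wI wS wT] := weight_metric I.
have Q0 := capacity_gt0 I.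
elim: h s => [|x h IH] s; first by rewrite /= addr0.
move=> /= /andP[lx lh] ls; apply: (le_trans (IH _ lh (load_move lx ls))).
case: x lx lh => [y|v|y].
- by move=> /= /andP[/eqP -> _] _; rewrite wI !mulr0 add0r.
- move=> /= _ _; have /andP[l0 lQ] := ls.
  have : 0 <= load s / Q <= 1.
    apply/andP; split; first by rewrite divr_ge0 // ltW.
    by rewrite ler_pdivrMr // mul1r.
  rewrite -mulrA; set z := load s / Q => /andP[z0 z1].
  have := wT ord0 (pos s) v; have := wT ord0 v (pos s); rewrite (wS v (pos s)).
  have := w0 (pos s) v.
  nra.
(* A delivery of [y] lowers the first term by 2 y / Q times the distance to the depot and raises the
   second by as much. *)
- move=> /[dup] /andP[p0 _] _ _; rewrite service_deliver //=.
  rewrite le_eqVlt; apply/orP; left; apply/eqP; field; lra.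
Qed.

Variable d : 'I_n -> R.

Lemma valid_closed h : valid d h -> last ord0 (walk h) = ord0.
Proof. by case=> _; rewrite pos_foldl. Qed.

(** The itinerary starts and ends at the depot, where the distance factor of the potential vanishes,
    so only the service terms remain. The same happens in [valid_pathlen]. *)
Lemma valid_load_length h : valid d h -> service d <= load_length (vehicle0 I) h.
Proof.
case=> lh p0 dE; have [w0 wI wS wT] := weight_metric I.
have := load_length_ge lh; rewrite /= lexx ltW ?capacity_gt0 //= => /(_ isT).
rewrite p0 wI mulr0 add0r /= mul0r add0r.
have -> : delivered (foldl (@move R I) (vehicle0 I) h) = d by apply/funext.
have -> : service (fun=> 0) = 0 by rewrite /service big1 // => i _; rewrite mulr0.
by rewrite add0r.
Qed.

Lemma valid_pathlen h : valid d h -> 2 / Q * service d <= pathlen w ord0 (walk h).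
Proof.
case=> lh p0 dE; have [w0 wI wS wT] := weight_metric I.
have := pathlen_walk_ge lh; rewrite /= lexx ltW ?capacity_gt0 //= => /(_ isT).
rewrite p0 wI !mulr0 add0r.
have -> : delivered (foldl (@move R I) (vehicle0 I) h) = d by apply/funext.
have -> : service (fun=> 0) = 0 by rewrite /service big1 // => i _; rewrite mulr0.
by rewrite mulr0 !add0r.
Qed.

Lemma valid_cost_ge h : valid d h ->
  cost_a I * pathlen w ord0 (walk h) + cost_b I * service d <= cumulative_cost h.
Proof.
move=> vh; rewrite /cumulative_cost cost_fromE lerD2l.
by rewrite ler_wpM2l ?cost_b_ge0 ?valid_load_length.
Qed.

End LowerBounds.

(** * Determinacy of policies and forced visits *)

Section Policies.
Variables (R : realType) (I : instance R).
Notation n := (ncust I).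
Implicit Types (pi : policy I) (d : 'I_n -> R) (h : itinerary R n).

(** For a fixed seed and fixed demands, the common prefix [p] of two runs determines the next action
    or the stop, so they never diverge. *)
Lemma follows_inj pi u d h h' : follows pi u d h -> follows pi u d h' -> h = h'.
Proof.
move=> [fh eh] [fh' eh'].
suff H s s' p : h = p ++ s -> h' = p ++ s' -> s = s' by exact: (H h h' [::]).
elim: s s' p => [|x s IH] [|x' s'] p // hE hE'.
- by move: (fh' _ _ _ hE'); rewrite -[p]cats0 -hE eh.
- by move: (fh _ _ _ hE); rewrite -[p]cats0 -hE' eh'.
- have := fh _ _ _ hE; rewrite (fh' _ _ _ hE') => -[xE]; rewrite {}xE in hE' *.
  by rewrite (IH s' (rcons p x)) ?cat_rcons.
Qed.

Lemma policy_outcomeE pi u d h : follows pi u d h -> policy_outcome pi u d = h.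
Proof.
move=> fh; rewrite /policy_outcome; case: pselect => [ex|/(_ (ex_intro _ h fh))//].
by case: cid => /= h' fh'; exact: follows_inj fh' fh.
Qed.

(** The demand of a customer not visited in [h] never enters [revealed], so the policy cannot react
    to it. *)
Lemma follows_unvisited pi u d d' i h :
  (forall j, j != i -> d' j = d j) -> ~~ visits h (lift ord0 i) ->
  follows pi u d h -> follows pi u d' h.
Proof.
move=> dd' nv [fh eh].
have rev h1 h2 : h = h1 ++ h2 -> revealed d' h1 = revealed d h1.
  move=> hE; apply/funext => j; rewrite /revealed.
  case: (eqVneq j i) => [->|/dd' -> //].
  by move: nv; rewrite hE /visits has_cat negb_or => /andP[/negbTE -> _].
split=> [h1 h2 x hE|]; first by rewrite (rev _ _ hE) (fh _ _ _ hE).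
by rewrite (rev h [::]) ?cats0.
Qed.

(* If customer i were skipped, the policy would act alike had its demand been
   x, and so would fail to deliver x. *)
Lemma admissible_visits pi u d i x : admissible pi -> 0 <= u <= 1 -> possible d ->
  x != 0 ->
  (forall e : R, 0 < e -> (0 < prob I (demand I i @^-1` ball x e))%E) ->
  visits (policy_outcome pi u d) (lift ord0 i).
Proof.
move=> [adm _] u01 pd x0 px.
have [h [fh [_ _ dh]]] := adm u d u01 pd.
rewrite (policy_outcomeE fh); apply/negPn/negP => nv.
pose d' j := if j == i then x else d j.
have pd' : possible d' by move=> j e e0; rewrite /d'; case: eqP => [->|_]; [exact: px|exact: pd].
have [h' [fh' [_ _ dh']]] := adm u d' u01 pd'.
have fhd' : follows pi u d' h.
  by apply: (follows_unvisited _ nv fh) => j /negbTE; rewrite /d' => ->.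
have hh := follows_inj fhd' fh'; subst h'.
have := dh' i; rewrite delivered_unvisited //= /d' eqxx => xE.
by rewrite -xE eqxx in x0.
Qed.

End Policies.

(** * The itinerary along a given order of customers *)

Section Route.
Variables (R : realType) (I : instance R) (q : R).
Notation n := (ncust I).
Notation w := (weight I).
Notation Q := (capacity I).
Notation vertex := (lift (ord0 : 'I_n.+1)).
Implicit Types (d : 'I_n -> R) (i : 'I_n) (L : R) (p : 'I_n.+1) (vs : seq 'I_n).

(** The maximum covers demands above [q]: such a customer leaves the load as it was on arrival, so
    the loads between customers stay in [0, q]. *)
Definition refill d i : R := Num.max q (d i).

Definition next_load d L i : R :=
  if d i <= L then L - d i else refill d i + L - d i.

Definition visit d L i : itinerary R n :=
  if d i <= L then [:: Go R (vertex i); Deliver n (d i)]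
  else [:: Go R (vertex i); Deliver n L; Go R ord0; SetLoad n (refill d i);
           Go R (vertex i); Deliver n (d i - L)].

(** Driving to the current vertex is not legal, hence the test before the final return. *)
Fixpoint route d p L vs : itinerary R n :=
  if vs is i :: vs' then visit d L i ++ route d (vertex i) (next_load d L i) vs'
  else if p == ord0 then [::] else [:: Go R ord0].

(** The way to the depot is made empty, so only the way back to the customer carries the refill. *)
Definition trip_cost d L i : R :=
  if d i <= L then 0
  else w ord0 (vertex i) * (cost_a I + cost_a I + cost_b I * refill d i).

Fixpoint route_cost d p L vs : R :=
  if vs is i :: vs' then
    (cost_a I + cost_b I * L) * w p (vertex i) + trip_cost d L i +
    route_cost d (vertex i) (next_load d L i) vs'
  else (cost_a I + cost_b I * L) * w p ord0.

Hypothesis q0Q : 0 <= q <= Q.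


Lemma next_load_range d L i : 0 <= d i -> 0 <= L <= q ->
  0 <= next_load d L i <= q.
Proof.
rewrite /next_load /refill => d0 /andP[L0 Lq].
by case: (lerP (d i) L) => dL; case: (lerP q (d i)) => qd; apply/andP; split; lra.
Qed.

Lemma cost_from_cat (s : vehicle I) h1 h2 :
  cost_from s (h1 ++ h2) = cost_from s h1 + cost_from (foldl (@move R I) s h1) h2.
Proof. by elim: h1 s => [|x h IH] s /=; rewrite ?add0r // IH addrA. Qed.

Lemma all_legal_cat (s : vehicle I) h1 h2 :
  all_legal s (h1 ++ h2) = all_legal s h1 && all_legal (foldl (@move R I) s h1) h2.
Proof. by elim: h1 s => [|x h IH] s //=; rewrite IH andbA. Qed.

Lemma foldl_visit d p L i (del : 'I_n -> R) :
  foldl (@move R I) (Vehicle p L del) (visit d L i) =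
  Vehicle (vertex i) (next_load d L i)
    (fun j => del j + (if j == i then d i else 0)).
Proof.
rewrite /visit /next_load; case: ifP => dL /=; congr Vehicle.
- by apply/funext => j; rewrite (inj_eq lift_inj) eq_sym.
- by ring.
- apply/funext => j; rewrite (inj_eq lift_inj) eq_sym.
  by case: ifP => _; rewrite ?addr0 //; ring.
Qed.

Lemma visit_legal d p L i del : 0 <= d i <= Q -> 0 <= L <= q -> vertex i != p ->
  all_legal (Vehicle p L del : vehicle I) (visit d L i).
Proof.
move=> /andP[d0 dQ] /andP[L0 Lq] ip; have /andP[q0 qQ] := q0Q.
have iv : vertex i != ord0 by rewrite eq_sym neq_lift.
have iv' : ord0 != vertex i by rewrite neq_lift.
rewrite /visit; case: (lerP (d i) L) => dL /=; rewrite ip ?iv ?iv' ?eqxx /= ?d0 ?dL //.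
rewrite L0 lexx /= !andbT /refill.
by case: (lerP q (d i)) => qd; repeat (apply/andP; split); lra.
Qed.

Lemma visit_cost d p L i del :
  cost_from (Vehicle p L del : vehicle I) (visit d L i) =
  (cost_a I + cost_b I * L) * w p (vertex i) + trip_cost d L i.
Proof.
have [_ _ wS _] := weight_metric I.
by rewrite /visit /trip_cost; case: ifP => _ /=; rewrite ?(wS (vertex i)); ring.
Qed.

Lemma route_costE d p L vs del :
  cost_from (Vehicle p L del : vehicle I) (route d p L vs) = route_cost d p L vs.
Proof.
have [_ w0 _ _] := weight_metric I.
elim: vs p L del => [|i vs IH] p L del /=.
  by case: eqP => [->|_] /=; rewrite ?w0 ?mulr0 // addr0; ring.
by rewrite cost_from_cat visit_cost foldl_visit IH.
Qed.

Lemma route_valid d p L vs del :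
  (forall i, 0 <= d i <= Q) -> 0 <= L <= q -> uniq vs ->
  p \notin map vertex vs ->
  let s := Vehicle p L del : vehicle I in
  let f := foldl (@move R I) s (route d p L vs) in
  [/\ all_legal s (route d p L vs), pos f = ord0
    & forall i, delivered f i = del i + (if i \in vs then d i else 0)].
Proof.
move=> dQ; elim: vs p L del => [|i vs IH] p L del Lq.
  move=> _ _ /=; case: (eqVneq p ord0) => [->|p0] /=.
    by split=> // j; rewrite addr0.
  by split=> [||j]; rewrite ?addr0 // andbT eq_sym.
move=> /= /andP[ivs uvs]; rewrite inE negb_or => /andP[pi pvs].
rewrite all_legal_cat foldl_cat foldl_visit visit_legal // 1?eq_sym //=.
have /andP[di0 _] := dQ i.
have [|||lg ps dl] := IH (vertex i) (next_load d L i)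
  (fun j => del j + (if j == i then d i else 0)); rewrite ?next_load_range //.
  by rewrite mem_map //; exact: lift_inj.
split=> // j; rewrite dl inE -addrA; congr (_ + _).
case: (eqVneq j i) => [->|ji] /=; last by rewrite add0r.
by rewrite (negbTE ivs) addr0.
Qed.

Lemma trip_cost_ge0 d L i : 0 <= d i -> 0 <= trip_cost d L i.
Proof.
move=> d0; have [w0 _ _ _] := weight_metric I; rewrite /trip_cost; case: ifP => // _.
have a0 := cost_a_ge0 I; have b0 := cost_b_ge0 I.
by rewrite mulr_ge0 // !addr_ge0 // mulr_ge0 // /refill le_max d0 orbT.
Qed.

Lemma route_cost_ge0 d p L vs : (forall i, 0 <= d i) -> 0 <= L <= q ->
  0 <= route_cost d p L vs.
Proof.
move=> d0; have [w0 _ _ _] := weight_metric I.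
have a0 := cost_a_ge0 I; have b0 := cost_b_ge0 I.
have H p' v L' : 0 <= L' <= q -> 0 <= (cost_a I + cost_b I * L') * w p' v.
  by move=> /andP[L0 _]; rewrite mulr_ge0 // addr_ge0 // mulr_ge0.
elim: vs p L => [|i vs IH] p L Lq /=; first exact: H.
by rewrite !addr_ge0 ?H ?trip_cost_ge0 ?IH // next_load_range.
Qed.

(** [next_load q d L i - L + d i] is the amount loaded during the visit: 0 or the refill. A refill
    is at least [q], so the share [kappa] pays for the driving. The bound is linear in the loads, so
    its mean can be found without knowing how likely a refill is. *)
Lemma trip_cost_le d L i (kappa : R) : 0 <= kappa -> 2 * cost_a I <= kappa * q ->
  trip_cost d L i <= w ord0 (vertex i) * (kappa + cost_b I) *
                     (next_load d L i - L + d i).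
Proof.
move=> k0 kq; have [w0 _ _ _] := weight_metric I; have b0 := cost_b_ge0 I.
rewrite /trip_cost /next_load; case: ifP => _.
  by rewrite (_ : _ - L + _ = 0) ?mulr0 //; ring.
rewrite (_ : _ - L + _ = refill d i); last by ring.
rewrite -mulrA ler_wpM2l // mulrDl lerD2r -mulr2n -mulr_natl.
by apply: (le_trans kq); rewrite ler_wpM2l // /refill le_max lexx.
Qed.

(* The loads of a run are rotations of the circle of length q. *)
Definition rotation (c u : R) : R := u - c + (u < c)%R%:R.

Lemma rotation_range c u : 0 <= c <= 1 -> 0 <= u <= 1 -> 0 <= rotation c u <= 1.
Proof.
by rewrite /rotation => /andP[c0 c1] /andP[u0 u1]; case: ltrP => uc /=; apply/andP; split; lra.
Qed.

(** A demand of at most [q] lowers the load by [d i] modulo [q], which moves the offset [c] by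
    [d i / q] modulo 1. A larger demand leaves load and offset alone, and for [q = 0] all loads are
    0. *)
Lemma next_load_rotation d i c : 0 <= d i -> 0 <= c <= 1 ->
  exists2 c', 0 <= c' <= 1 &
    forall u, 0 <= u <= 1 -> next_load d (q * rotation c u) i = q * rotation c' u.
Proof.
move=> d0 c01; have /andP[q0 _] := q0Q; have /andP[c0 c1] := c01.
have [q00|qn0] := eqVneq q 0.
  exists 0; rewrite ?lexx ?ler01 // => u _; rewrite /next_load /refill q00 !mul0r.
  by case: (lerP (d i) 0) => h1; lra.
have qp : 0 < q by rewrite lt_neqAle eq_sym qn0.
have [qd|dq] := ltrP q (d i).
  exists c => // u u01; have /andP[r0 r1] := rotation_range c01 u01.
  rewrite /next_load /refill (max_idPr (ltW qd)).
  by case: lerP => h1; [exfalso; nra | lra].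
pose e := d i / q.
have dE : d i = q * e by rewrite /e mulrC divfK.
have e0 : 0 <= e by rewrite divr_ge0.
have e1 : e <= 1 by rewrite ler_pdivrMr // mul1r.
have nE u : next_load d (q * rotation c u) i =
    q * (if e <= rotation c u then rotation c u - e else 1 + rotation c u - e).
  rewrite /next_load dE ler_pM2l // /refill; case: ifP => _; first by ring.
  by rewrite (max_idPl dq); ring.
have [ce|ce] := lerP (c + e) 1.
  exists (c + e); first by apply/andP; split; lra.
  move=> u /andP[u0 u1]; rewrite nE; congr (_ * _); rewrite /rotation.
  by case: (ltrP u c) => h1; case: (ltrP u (c + e)) => h2; case: lerP => h3 /=; 
    move: h3; rewrite /=; lra.
exists (c + e - 1); first by apply/andP; split; lra.
move=> u /andP[u0 u1]; rewrite nE; congr (_ * _); rewrite /rotation.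
by case: (ltrP u c) => h1; case: (ltrP u (c + e - 1)) => h2; case: lerP => h3 /=;
  move: h3; rewrite /=; lra.
Qed.

End Route.

(** * Means over a uniform seed *)

Section Mean.
Variable R : realType.
Local Notation mu := (@lebesgue_measure R).
Local Notation D := (`[0%R, 1%R]%classic : set (measurableTypeR R)).
Implicit Types (f g : measurableTypeR R -> R).

Let mD : measurable D. Proof. exact: measurable_itv. Qed.

Let muD : mu D = 1%E.
Proof. by rewrite lebesgue_measure_itv /= lte_fin ltr01 oppr0 adde0. Qed.

(** Integrability is bundled with the value, so that sums and multiples need no side conditions. *)
Definition has_mean f (m : R) : Prop :=
  mu.-integrable D (EFin \o f) /\ (\int[mu]_(x in D) (f x)%:E = m%:E)%E.

Lemma has_meanD f g m m' : has_mean f m -> has_mean g m' ->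
  has_mean (fun u => f u + g u) (m + m').
Proof.
move=> [fi fm] [gi gm]; split.
  by rewrite (_ : _ \o _ = (EFin \o f) \+ (EFin \o g))%E //; exact: integrableD.
under eq_integral do rewrite EFinD.
by rewrite (integralD mD fi gi) fm gm.
Qed.

Lemma has_meanZ r f m : has_mean f m -> has_mean (fun u => r * f u) (r * m).
Proof.
move=> [fi fm]; split.
  rewrite (_ : _ \o _ = (fun u => r%:E * (EFin \o f) u)%E) //.
  exact: integrableZl.
under eq_integral do rewrite EFinM.
by rewrite (integralZl mD fi) fm.
Qed.

Lemma eq_has_mean f g m m' : f =1 g -> m = m' -> has_mean f m -> has_mean g m'.
Proof. by move=> /funext -> ->. Qed.

Lemma bounded_has_mean f m (M : R) : measurable_fun [set: measurableTypeR R] f ->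
  (forall u, D u -> `|f u| <= M) ->
  (\int[mu]_(x in D) (f x)%:E = m%:E)%E -> has_mean f m.
Proof.
move=> mf fM fm; split => //; apply: measurable_bounded_integrable => //.
- by rewrite [X in (X < _)%E]muD ltry.
- exact: measurable_funS mf.
- exists M; split; first exact: num_real.
  by move=> x Mx u Du; apply: (le_trans (fM _ Du)); exact: ltW.
Qed.

Lemma has_mean_cst r : has_mean (fun=> r) r.
Proof.
apply: (@bounded_has_mean _ _ `|r|) => //.
by rewrite (integral_cst mu mD r%:E) [X in (_ * X)%E]muD mule1.
Qed.

Lemma has_mean_id : has_mean id (2^-1).
Proof.
apply: (@bounded_has_mean _ _ 1) => //.
  by move=> u; rewrite /= in_itv /= => /andP[u0 u1]; rewrite ger0_norm.
have c := @continuous_horner R (2^-1 *: 'X^2).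
rewrite (@continuous_FTC2 R id (horner (2^-1 *: 'X^2)) 0 1) ?ltr01 //.
- rewrite -EFinB !hornerE; congr EFin => /=.
  by rewrite !mulr0 !mulr1 subr0.
- by apply: continuous_subspaceT => x; exact: cvg_id.
- split=> [x _||]; first exact: derivable_horner.
    exact/cvg_at_right_filter/c.
  exact/cvg_at_left_filter/c.
- move=> x _; rewrite -derivE derivZ derivXn !hornerE /=.
  by rewrite -mulr_natl; field.
Qed.

Lemma has_mean_lt c : 0 <= c <= 1 -> has_mean (fun u : R => (u < c)%R%:R) c.
Proof.
move=> /andP[c0 c1].
have E (u : R) : (u < c)%R%:R = \1_(`]-oo, c[%classic : set R) u :> R.
  by rewrite indicE mem_setE in_itv.
apply: (@bounded_has_mean _ _ 1).
- rewrite (_ : (fun _ => _) = \1_(`]-oo, c[%classic : set (measurableTypeR R))).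
    exact: measurable_indic.
  by apply/funext => u; exact: E.
- by move=> u _; case: ltrP => _; rewrite /= ?normr1 ?normr0.
under eq_integral do rewrite E.
rewrite (integral_indic mu mD (measurable_itv `]-oo, c[)).
transitivity (mu `[0%R, c[%classic).
  congr (mu _); apply/seteqP; split=> u; rewrite /= !in_itv /=.
    by move=> [-> /andP[-> _]].
  by move=> /andP[-> uc]; rewrite uc /= (le_trans (ltW uc)).
rewrite lebesgue_measure_itv /= lte_fin.
by case: ltrP => [_|c0']; rewrite ?oppr0 ?adde0 // (@le_anti _ _ c 0) // c0' c0.
Qed.

(** The indicator of [u < c] has mean [c], which makes up for the shift by [- c]. *)
Lemma has_mean_rotation c : 0 <= c <= 1 -> has_mean (rotation c) (2^-1).
Proof.
move=> c01.
have := has_meanD (has_meanD has_mean_id (has_mean_cst (- c))) (has_mean_lt c01).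
by rewrite subrK.
Qed.

End Mean.

Section RouteMean.
Variables (R : realType) (I : instance R) (q kappa : R).
Notation n := (ncust I).
Notation w := (weight I).
Notation Q := (capacity I).
Notation vertex := (lift (ord0 : 'I_n.+1)).
Hypotheses (q0Q : 0 <= q <= Q) (kappa0 : 0 <= kappa).
Hypothesis kq : 2 * cost_a I <= kappa * q.

(** The function [g] is affine in the loads, all of mean q / 2. So an edge costs a + b q / 2 per
    unit of length on average, and in the bound for a refill trip the loads before and after the
    visit cancel, leaving the demand. *)
Lemma route_cost_mean_le d p c vs : (forall i, 0 <= d i) -> 0 <= c <= 1 ->
  exists2 g : R -> R,
    forall u, 0 <= u <= 1 -> route_cost q d p (q * rotation c u) vs <= g u
    & has_mean g ((cost_a I + cost_b I * (q / 2)) *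
                    pathlen w p (rcons (map vertex vs) ord0) +
                  (kappa + cost_b I) * \sum_(i <- vs) w ord0 (vertex i) * d i).
Proof.
move=> d0; have b0 := cost_b_ge0 I.
have H c' (x : R) : 0 <= c' <= 1 ->
    has_mean (fun u => (cost_a I + cost_b I * (q * rotation c' u)) * x)
             ((cost_a I + cost_b I * (q / 2)) * x).
  move=> c01.
  apply: eq_has_mean (has_meanD (has_mean_cst (cost_a I * x))
    (has_meanZ (cost_b I * q * x) (has_mean_rotation c01))); last by ring.
  by move=> u; ring.
elim: vs p c => [|i vs IH] p c c01 /=.
  exists (fun u => (cost_a I + cost_b I * (q * rotation c u)) * w p ord0) => //.
  by rewrite big_nil mulr0 !addr0; exact: H.
have [c' c'01 nE] := next_load_rotation q0Q (d0 i) c01.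
have [g gle gm] := IH (vertex i) c' c'01.
pose l := w ord0 (vertex i) * (kappa + cost_b I).
exists (fun u => (cost_a I + cost_b I * (q * rotation c u)) * w p (vertex i) +
   l * (q * rotation c' u + - q * rotation c u + d i) + g u).
  move=> u u01; rewrite nE //; apply: lerD; last exact: gle.
  rewrite lerD2l mulNr -nE //; exact: trip_cost_le.
have := has_meanD (has_meanD (H c (w p (vertex i)) c01)
  (has_meanZ l (has_meanD (has_meanD (has_meanZ q (has_mean_rotation c'01))
     (has_meanZ (- q) (has_mean_rotation c01))) (has_mean_cst (d i))))) gm.
rewrite big_cons; set m1 := (X in has_mean _ X -> _).
set m2 := (X in _ -> has_mean _ X); suff -> : m1 = m2 by [].
by rewrite /m1 /m2 /l; ring.
Qed.

End RouteMean.

(** * Supports of the demand laws and essential customers *)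

Section Support.
Variables (R : realType) (disp : measure_display) (T : measurableType disp).
Variables (P : probability T R) (X : {RV P >-> R}).

Definition in_support (x : R) : Prop :=
  forall e : R, 0 < e -> (0 < P (X @^-1` ball x e))%E.

Lemma measurable_preimage_ball (x e : R) : measurable (X @^-1` ball x e).
Proof.
rewrite -[X in measurable X]setTI.
by apply: measurable_funP => //; exact: measurable_ball.
Qed.

(* The complement of the support is covered by the null balls with rational
   centre and radius. *)
Lemma negligible_not_support : P.-negligible [set t | ~ in_support (X t)].
Proof.
pose B (c : rat * rat) := X @^-1` ball (ratr c.1 : R) (ratr c.2).
pose F k : set T := if unpickle k is Some c then
  (if P (B c) == 0%E then B c else set0) else set0.
suff sub : [set t | ~ in_support (X t)] `<=` \bigcup_k F k.
  apply: (negligibleS sub).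
  apply: negligible_bigcup => k; rewrite /F; case: unpickle => [c|]; last first.
    exact: negligible_set0.
  case: eqP => [Pc|_]; last exact: negligible_set0.
  by apply/negligibleP => //; exact: measurable_preimage_ball.
move=> t /= /existsNP[e] /not_implyP[e0 /negP]; rewrite -leNgt => Pe.
have oe : open (ball (X t) e) by exact: ball_open.
have Xt : X t \in (ball (X t) e : set R) by apply/mem_set; exact: ballxx.
have [c [r /= [Bx Bs]]] := open_subball_rat oe Xt.
exists (pickle (c, r)); [exact: Logic.I|rewrite /F pickleK].
have -> : P (B (c, r)) = 0%E.
  apply/eqP; rewrite eq_le measure_ge0 andbT; apply: le_trans Pe.
  apply: le_measure; rewrite ?inE; [exact: measurable_preimage_ball..|].
  exact: preimage_subset.
by rewrite eqxx; exact/set_mem.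
Qed.

End Support.

Section Essential.
Variables (R : realType) (I : instance R).
Notation n := (ncust I).

(** Stated through the distribution function because this is what a program can query; demands are
    nonnegative, so its value at 0 is the probability of demand 0. *)
Definition essential (i : 'I_n) : bool := fine (cdf (demand I i) 0) < 1.

Lemma measurable_demand_le0 i : measurable (demand I i @^-1` `]-oo, 0]%classic).
Proof.
rewrite -[X in measurable X]setTI.
by apply: measurable_funP => //; exact: measurable_itv.
Qed.

Lemma essentialN i : ~~ essential i ->
  prob I (~` (demand I i @^-1` `]-oo, 0]%classic)) = 0%E.
Proof.
have mA := measurable_demand_le0 i.
rewrite /essential -leNgt => H.
have P1 := probability_le1 (prob I) mA.
have Pf := fin_num_measure (prob I) _ mA.
rewrite probability_setC //.
suff -> : prob I (demand I i @^-1` `]-oo, 0]%classic) = 1%E by rewrite subee.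
apply/eqP; rewrite eq_le P1 /= -(fineK Pf) lee_fin; exact: H.
Qed.

(** The ball of radius [|d i|] around a nonzero [d i] misses 0, so its preimage lies in the null
    event of a positive demand. *)
Lemma inessential_demand0 i d : ~~ essential i -> possible d -> d i = 0.
Proof.
move=> ei pd; apply/eqP/negPn/negP => di0.
have := pd i `|d i|; rewrite normr_gt0 => /(_ di0); apply/negP; rewrite -leNgt.
rewrite -(essentialN ei); apply: le_measure; rewrite ?inE.
- exact: measurable_preimage_ball.
- by apply: measurableC; exact: measurable_demand_le0.
move=> t /=; rewrite /ball /= in_itv /= => dt; apply/negP; rewrite -ltNge.
have /andP[t0 _] := demand_range i t.
rewrite lt_neqAle t0 andbT; apply/eqP => t0'.
by move: dt; rewrite -t0' subr0 ltxx.
Qed.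

(** Otherwise every positive value of the demand would lie outside the support, and the event of a
    positive demand would be null. *)
Lemma essential_support i : essential i ->
  exists2 x, x != 0 & in_support (demand I i) x.
Proof.
move=> ei; apply: contrapT => /forall2NP H.
have mA := measurable_demand_le0 i.
have : prob I (~` (demand I i @^-1` `]-oo, 0]%classic)) = 0%E.
  apply/negligibleP; first exact: measurableC.
  apply: negligibleS (negligible_not_support (demand I i)) => t /=.
  rewrite in_itv /= => /negP; rewrite -ltNge => t0.
  by case: (H (demand I i t)) => // /negP; rewrite gt_eqF.
rewrite probability_setC // => /eqP; rewrite sube_eq ?add0e ?fin_num_measure // => /eqP E.
by move: ei; rewrite /essential /cdf /distribution /pushforward /= -E /= ltxx.
Qed.

Lemma negligible_impossible :
  (prob I).-negligible [set t | ~ possible (fun i => demand I i t)].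
Proof.
pose F k : set (sample I) := if insub k is Some i then
  [set t | ~ in_support (demand I i) (demand I i t)] else set0.
suff sub : [set t | ~ possible (fun i => demand I i t)] `<=` \bigcup_k F k.
  apply: (negligibleS sub).
  apply: negligible_bigcup => k; rewrite /F; case: insubP => [i _ _|_].
    exact: negligible_not_support.
  exact: negligible_set0.
move=> t /= /existsNP[i Hi]; exists (val i) => //.
by rewrite /F valK.
Qed.

End Essential.

(** * Expected costs as iterated integrals *)

Section Expectation.
Variables (R : realType) (I : instance R).
Notation n := (ncust I).
Notation w := (weight I).
Notation Q := (capacity I).
Notation vertex := (lift (ord0 : 'I_n.+1)).
Notation P := (prob I).
Notation U := (uniform_prob (@ltr01 R)).

Lemma measurable_demand_fst i :
  measurable_fun [set: sample I * R] (fun z => demand I i z.1).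
Proof. exact: measurableT_comp. Qed.

Lemma measurable_route_cost q p vs (L : sample I * R -> R) :
  measurable_fun [set: sample I * R] L ->
  measurable_fun [set: sample I * R]
    (fun z => route_cost q (fun i => demand I i z.1) p (L z) vs).
Proof.
have md := measurable_demand_fst.
elim: vs p L => [|i vs IH] p L mL /=.
  apply: measurable_funM => //; apply: measurable_funD => //.
  exact: measurable_funM.
have mr : measurable_fun [set: sample I * R]
    (fun z => refill q (fun i => demand I i z.1) i).
  by rewrite /refill; apply: measurable_maxr.
have mt : measurable_fun [set: sample I * R] (fun z => demand I i z.1 <= L z).
  exact: measurable_fun_ler.
apply: measurable_funD; first apply: measurable_funD.
- apply: measurable_funM => //; apply: measurable_funD => //.
  exact: measurable_funM.
- rewrite /trip_cost; apply: measurable_fun_ifT => //.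
  apply: measurable_funM => //; apply: measurable_funD => //.
  exact: measurable_funM.
- apply: IH; rewrite /next_load; apply: measurable_fun_ifT => //.
    exact: measurable_funB.
  by apply: measurable_funB => //; exact: measurable_funD.
Qed.

Lemma measurable_service :
  measurable_fun [set: sample I] (fun t => service (fun i => demand I i t)).
Proof.
rewrite /service; apply: measurable_sum => i.
by apply: measurable_funM.
Qed.

Lemma service_ge0 t : 0 <= service (fun i => demand I i t).
Proof.
have [w0 _ _ _] := weight_metric I.
by apply: sumr_ge0 => i _; have /andP[? _] := demand_range i t; rewrite mulr_ge0.
Qed.

Definition mean_service : R :=
  fine (\int[P]_t (service (fun i => demand I i t))%:E)%E.

Lemma service_integrable :
  P.-integrable setT (EFin \o (fun t => service (fun i => demand I i t))).
Proof.
apply: measurable_bounded_integrable => //.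
- by apply: (le_lt_trans (probability_le1 _ _)); rewrite ?ltry.
- exact: measurable_service.
exists (\sum_i w ord0 (vertex i) * Q); split; first exact: num_real.
move=> x Mx t _ /=; apply: le_trans (ltW Mx); rewrite ger0_norm ?service_ge0 //.
have [w0 _ _ _] := weight_metric I.
by apply: ler_sum => i _; have /andP[_ ?] := demand_range i t; rewrite ler_wpM2l.
Qed.

Lemma integral_affine_service (x y : R) :
  (\int[P]_t (x + y * service (fun i => demand I i t))%:E = (x + y * mean_service)%:E)%E.
Proof.
have Si := service_integrable.
have cx : P.-integrable setT (cst x%:E) by exact: finite_measure_integrable_cst.
under eq_integral do rewrite EFinD EFinM.
rewrite integralD //=; last exact: integrableZl.
rewrite integral_cst // [X in (_ * X)%E](probability_setT P) mule1 integralZl //.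
by rewrite /mean_service EFinD EFinM fineK // integrable_fin_num.
Qed.

Lemma mean_service_ge0 : 0 <= mean_service.
Proof.
by apply: fine_ge0; apply: integral_ge0 => t _; rewrite lee_fin service_ge0.
Qed.

Lemma uniform_prob01 : U `[0%R, 1%R]%classic = 1%E.
Proof. by rewrite /uniform_prob integral_uniform_pdf1. Qed.

(** The comparison with [g] is known only for possible demands and seeds in [0, 1], that is, almost
    everywhere. Hence the passage through the maximum [f], which has the same integral as the cost
    and is at least [g] everywhere. *)
Lemma integral_fst_le_expected_cost (H : outcome I) (g : sample I -> R) :
  measurable_fun setT (realized_cost H) -> measurable_fun setT g ->
  (forall t, 0 <= g t) ->
  (forall t u, possible (fun i => demand I i t) -> 0 <= u <= 1 ->
     g t <= realized_cost H (t, u)) ->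
  (\int[P]_t (g t)%:E <= expected_cost H)%E.
Proof.
move=> mH mg g0 gH.
have mg1 : measurable_fun [set: sample I * R] (fun z => g z.1).
  exact: measurableT_comp.
have -> : (\int[P]_t (g t)%:E = \int[P \x U]_z (g z.1)%:E)%E.
  have mgE : measurable_fun [set: sample I * R] (fun z : sample I * R => (g z.1)%:E).
    exact/measurable_EFinP.
  have gE0 (z : sample I * R) : (0 <= (g z.1)%:E)%E by rewrite lee_fin.
  apply/esym/(etrans (@fubini_tonelli1 _ _ _ _ _ P U _ mgE gE0)).
  apply: eq_integral => t _; rewrite /fubini_F /= integral_cst //.
  by rewrite [X in (_ * X)%E](probability_setT U) mule1.
pose f z := Num.max (realized_cost H z) (g z.1).
have mf : measurable_fun [set: sample I * R] f by exact: measurable_maxr.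
have -> : expected_cost H = (\int[P \x U]_z (f z)%:E)%E.
  apply: ae_eq_integral => //; [exact/measurable_EFinP..|].
  have [N [mN PN sN]] := negligible_impossible I.
  exists ((N `*` setT) `|` (setT `*` (~` `[0%R, 1%R]%classic))); split.
  - apply: measurableU; apply: measurableX => //.
    by apply: measurableC; exact: measurable_itv.
  - apply/eqP; rewrite eq_le measure_ge0 andbT.
    have mC : measurable (~` `[0%R, 1%R]%classic : set (measurableTypeR R)).
      by apply: measurableC; exact: measurable_itv.
    have E1 := product_measure1E P U mN measurableT.
    have E2 := product_measure1E P U measurableT mC.
    apply: (le_trans (measureU2 _ _ _)); [exact: measurableX..|].
    rewrite [X in (X + _)%E]E1 [X in (_ + X)%E]E2.
    rewrite [X in (X * _ + _)%E]PN mul0e add0e.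
    rewrite [X in (_ * X)%E](_ : _ = 0)%E ?mule0 //.
    rewrite [LHS](probability_setC U); last exact: measurable_itv.
    by rewrite [X in (_ - X)%E]uniform_prob01 subee.
  move=> [t u] /= /not_implyP[_] ne.
  have [pt|npt] := pselect (possible (fun i => demand I i t)); last first.
    by left; split => //; exact: (sN t npt).
  right; split=> //=; rewrite in_itv /= => u01; apply: ne; congr EFin.
  by rewrite /f max_l //; exact: gH.
apply: ge0_le_integral => //.
- by move=> z _; rewrite lee_fin.
- exact/measurable_EFinP.
- exact/measurable_EFinP.
- by move=> z _; rewrite lee_fin /f le_max lexx orbT.
Qed.

(** By Tonelli the seed is integrated out first, at fixed demands, where [g] dominates the cost and
    has mean [m t]. *)
Lemma expected_cost_le_mean (H : outcome I) (m : sample I -> R) :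
  measurable_fun setT (realized_cost H) -> measurable_fun setT m ->
  (forall z, 0 <= realized_cost H z) ->
  (forall t, exists2 g : R -> R,
     forall u, 0 <= u <= 1 -> realized_cost H (t, u) <= g u & has_mean g (m t)) ->
  (expected_cost H <= \int[P]_t (m t)%:E)%E.
Proof.
move=> mH mm H0 Hg.
have mHE : measurable_fun [set: sample I * R] (EFin \o realized_cost H).
  exact/measurable_EFinP.
have HE0 z : (0 <= (EFin \o realized_cost H) z)%E by rewrite lee_fin.
have -> : expected_cost H = (\int[P]_t fubini_F U (EFin \o realized_cost H) t)%E.
  exact: (@fubini_tonelli1 _ _ _ _ _ P U _ mHE HE0).
apply: ge0_le_integral => //.
- by move=> t _; apply: integral_ge0 => u _.
- exact: measurable_fun_fubini_tonelli_F.
- exact/measurable_EFinP.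
move=> t _; have [g gle [gi gm]] := Hg t.
have mHt : measurable_fun [set: measurableTypeR R] (fun u => (realized_cost H (t, u))%:E).
  exact: (measurableT_comp mHE).
rewrite /fubini_F integral_uniform // subr0 invr1 mul1e -gm.
apply: ge0_le_integral => //=.
- by move=> u _; rewrite lee_fin.
- exact: measurable_funS mHt.
- by case/integrableP: gi.
Qed.

End Expectation.

(** * Weakest preconditions of loop-free code *)

Section WeakestPrecondition.
Variables (R : realType) (n : nat).
Variables (cdf : 'I_n -> R -> R) (dem : 'I_n -> R).

(* Loops are handled by triple_while, hence the value False here. *)
Fixpoint wp (c : com R) (m : memory R) (h : itinerary R n)
    (post : memory R -> itinerary R n -> Prop) : Prop :=
  match c with
  | CSkip => post m h
  | CSeq c1 c2 => wp c1 m h (fun m' h' => wp c2 m' h' post)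
  | CIf b c1 c2 => if beval m b then wp c1 m h post else wp c2 m h post
  | CWhile _ _ => False
  | CSetN x i e => post (setn m x (neval m i) (neval m e)) h
  | CSetR x i j e => post (setr m x (neval m i) (neval m j) (reval m e)) h
  | CCdf x i j e r =>
      post (setr m x (neval m i) (neval m j)
        (at_vertex 0 (cdf^~ (reval m r)) (inord (neval m e)))) h
  | CLoad e => post m (rcons h (SetLoad n (reval m e)))
  | CGo x i j e =>
      post (setr m x (neval m i) (neval m j)
              (at_vertex 0 dem (inord (neval m e))))
           (rcons h (Go R (inord (neval m e))))
  | CDeliver e => post m (rcons h (Deliver n (reval m e)))
  end.

Fixpoint duration (c : com R) : nat :=
  match c with
  | CSeq c1 c2 => (duration c1 + duration c2).+1
  | CIf _ c1 c2 => (maxn (duration c1) (duration c2)).+1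
  | _ => 1
  end.

Lemma triple_wp c m h post :
  wp c m h post -> triple cdf dem (duration c) c m h post.
Proof.
elim: c m h post => //=.
- by move=> m h post; exact: triple_skip.
- move=> c1 IH1 c2 IH2 m h post /IH1 H; apply: triple_seq.
  by apply: triple_post H _ => m' h'; exact: IH2.
- move=> b c1 IH1 c2 IH2 m h post H; apply: triple_if.
  case: ifP H => _ => [/IH1|/IH2] /triple_weaken; apply => //.
    exact: leq_maxl.
  exact: leq_maxr.
- by move=> x i e m h post; exact: triple_setn.
- by move=> x i j e m h post; exact: triple_setr.
- by move=> x i j e r m h post; exact: triple_cdf.
- by move=> e m h post; exact: triple_load.
- by move=> x i j e m h post; exact: triple_go.
- by move=> e m h post; exact: triple_deliver.
Qed.

End WeakestPrecondition.

(** * The program *)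

(* Natural arrays: 0 number of vertices, 1 and 2 loop counters, 3 collapse map,
   4 tour cursor, 5 position, 6 next vertex. Real arrays: 0 weights, 1 the
   parameters, 2 cdf value, 3 q, 4 load, 5 demand, 6 unused results, 7 refill.
   The arrays of the TSP program are shifted by 8. *)
Section Program.
Variables (R : realType) (alpha : R) (ctsp : com R).

Local Notation N0 := (NConst 0).
Local Notation nvar x := (NGet x N0).
Local Notation rvar x := (RGet R x N0 N0).
Local Notation param j := (RGet R 1 N0 (NConst j)).
Local Notation setnvar x e := (CSetN R x N0 e).
Local Notation setrvar x e := (CSetR x N0 N0 e).
Local Notation incr x := (setnvar x (NAdd (nvar x) (NConst 1))).
Local Notation ltn_exp e1 e2 := (BLeN R (NAdd e1 (NConst 1)) e2).

Definition mark_body : com R :=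
  CSeq (CCdf 2 N0 N0 (nvar 1) (RConst 0))
  (CSeq (CIf (BLeR (RConst 1) (rvar 2))
           (CSetN R 3 (nvar 1) N0) (CSetN R 3 (nvar 1) (nvar 1)))
        (incr 1)).

Definition mark : com R := CWhile (ltn_exp (nvar 1) (nvar 0)) mark_body.

Definition copy_body : com R :=
  CSeq (CSetR 8 (nvar 1) (nvar 2)
          (RGet R 0 (NGet 3 (nvar 1)) (NGet 3 (nvar 2)))) (incr 2).

Definition copy_row : com R :=
  CSeq (setnvar 2 N0)
  (CSeq (CWhile (ltn_exp (nvar 2) (nvar 0)) copy_body) (incr 1)).

Definition copy : com R :=
  CSeq (setnvar 1 N0)
  (CSeq (CWhile (ltn_exp (nvar 1) (nvar 0)) copy_row) (setnvar 8 (nvar 0))).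

Definition set_start : com R :=
  CSeq (CIf (BLeR (RMul (RMul (param 2) (RConst alpha)) (param 0))
                  (RMul (RConst 2) (param 1)))
          (setrvar 3 (param 0))
          (setrvar 3 (RDiv (RMul (RConst 2) (param 1))
                           (RMul (param 2) (RConst alpha)))))
  (CSeq (CIf (BLeR (param 3) (RConst 0)) (setrvar 4 (RConst 0))
           (CIf (BLeR (RConst 1) (param 3)) (setrvar 4 (rvar 3))
              (setrvar 4 (RMul (rvar 3) (param 3)))))
  (CSeq (CLoad (rvar 4))
  (CSeq (setnvar 4 N0) (CSeq (setnvar 5 N0) (setnvar 1 (NConst 1)))))).

(** The tour returned may start anywhere; natural array 9 is the output array 1 of the TSP program
    after the shift. *)
Definition find_depot : com R :=
  CWhile (BLeN R (NConst 1) (NGet 9 (nvar 4))) (incr 4).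

Definition visit_code : com R :=
  CSeq (CGo R 5 N0 N0 (nvar 6))
  (CSeq (setnvar 5 (nvar 6))
  (CIf (BLeR (rvar 5) (rvar 4))
     (CSeq (CDeliver (rvar 5)) (setrvar 4 (RSub (rvar 4) (rvar 5))))
     (CSeq (CDeliver (rvar 4))
     (CSeq (CGo R 6 N0 N0 N0)
     (CSeq (CIf (BLeR (rvar 3) (rvar 5)) (setrvar 7 (rvar 5))
              (setrvar 7 (rvar 3)))
     (CSeq (CLoad (rvar 7))
     (CSeq (CGo R 6 N0 N0 (nvar 6))
     (CSeq (CDeliver (RSub (rvar 5) (rvar 4)))
           (setrvar 4 (RSub (RAdd (rvar 7) (rvar 4)) (rvar 5))))))))))).

Definition advance : com R :=
  CSeq (incr 4)
  (CSeq (CIf (BLeN R (nvar 0) (nvar 4)) (setnvar 4 N0) (CSkip R))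
        (setnvar 6 (NGet 3 (NGet 9 (nvar 4))))).

(** The value 0 for the next vertex means that it collapses to the depot; it is then passed over. *)
Definition drive_body : com R :=
  CSeq advance
  (CSeq (CIf (BLeN R (NConst 1) (nvar 6)) visit_code (CSkip R)) (incr 1)).

Definition drive : com R :=
  CSeq (CWhile (ltn_exp (nvar 1) (nvar 0)) drive_body)
       (CIf (BLeN R (NConst 1) (nvar 5)) (CGo R 6 N0 N0 N0) (CSkip R)).

Definition vrp_program : com R :=
  CSeq mark (CSeq copy (CSeq (shiftc 8 ctsp)
    (CSeq set_start (CSeq find_depot drive)))).

End Program.

(** The seed is clamped to [0, 1], so that the load is legal for every real seed. *)
Definition start_load (R : realType) (q u : R) : R :=
  if u <= 0 then 0 else if 1 <= u then q else q * u.

(** The minimum of Q and 2 a / (b alpha), with the comparison multiplied out so that [b = 0] gives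
    [Q] without a division. *)
Definition fill_level (R : realType) (alpha Q a b : R) : R :=
  if b * alpha * Q <= 2 * a then Q else 2 * a / (b * alpha).

(** * Correctness and running time of the program *)

Section Verification.
Variables (R : realType) (alpha : R) (ctsp : com R) (I : instance R) (u : R).
Notation n := (ncust I).
Variables (cdf : 'I_n -> R -> R) (d : 'I_n -> R).
Notation w := (weight I).
Notation triple := (triple cdf d).
Implicit Types (m : memory R) (h : itinerary R n).

(** The depot reads the default 0 as its distribution function, hence its explicit exclusion; in the
    program both branches store 0 for vertex 0. *)
Definition marked (v : 'I_n.+1) : bool :=
  (v != ord0) && ~~ (1 <= at_vertex 0 (cdf^~ 0) v).

Definition inputs m : Prop :=
  [/\ nmem m 0 0 = n.+1, forall i j, rmem m 0 i j = weight_array w i j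
    & forall j, rmem m 1 0 j = [:: capacity I; cost_a I; cost_b I; u]`_j].

(** The TSP program expects zeros outside its input, so its arrays must be untouched beforehand. *)
Definition fresh_above m : Prop :=
  (forall x i, nmem m (x + 8) i = 0%N) /\ (forall x i j, rmem m (x + 8) i j = 0).

Definition collapse_map m : Prop :=
  forall v, (v <= n)%N -> nmem m 3 v = collapse marked (inord v).

Lemma fresh_setn m y i k : (y < 8)%N -> fresh_above m -> fresh_above (setn m y i k).
Proof. by move=> y8 [a b]; split=> // x j /=; case: eqP => [?|_]; [exfalso; lia | exact: a]. Qed.

Lemma fresh_setr m y i j r :
  (y < 8)%N -> fresh_above m -> fresh_above (setr m y i j r).
Proof. by move=> y8 [a b]; split=> // x j' k /=; case: eqP => [?|_]; [exfalso; lia | exact: b]. Qed.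

Lemma mark_correct m h : inputs m -> fresh_above m -> nmem m 1 0 = 0%N ->
  triple (n.+1 * (duration (mark_body R)).+1).+1 (mark R) m h (fun m' h' =>
    [/\ inputs m', fresh_above m', collapse_map m' & h' = h]).
Proof.
move=> im fm m1.
pose Inv k m' h' := [/\ (k <= n.+1)%N, nmem m' 1 0 = (n.+1 - k)%N,
  [/\ inputs m', fresh_above m' & h' = h]
  & forall v, (v < n.+1 - k)%N -> nmem m' 3 v = collapse marked (inord v)].
apply: (triple_post (triple_while (Inv := Inv) (K := n.+1) _ _ _)).
- by move=> k m' h' [kn k1 [[N0 _ _] _ _] _] /=; rewrite N0 k1; lia.
- move=> k m' h' [kn k1 [im' fm' hE] r]; apply: triple_wp => /=.
  have k1' : (n.+1 - k)%N = (n.+1 - k.+1).+1 by lia.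
  rewrite k1; set v := (n.+1 - k.+1)%N in k1 k1' r *.
  have vn : (v < n.+1)%N by rewrite /v; lia.
  have c0 : nat_of_ord (collapse marked (inord v)) =
      if 1 <= at_vertex 0 (cdf^~ 0) (inord v) then 0%N else v.
    rewrite /collapse /marked; case: (1 <= _); rewrite ?andbF // andbT.
    case: eqVneq => [/(congr1 val) /=|_] /=; rewrite inordK //; lia.
  case: ifP c0 => _ c0; (split;
    [ by lia | by rewrite /= addn1 k1'
    | by split; [exact: im' | do 2!apply: fresh_setn => //; exact: fresh_setr
                | exact: hE]
    | move=> a; rewrite k1' ltnS leq_eqVlt /= => /orP[/eqP ->|av];
        by rewrite ?eqxx ?c0 //= ltn_eqF // r ]).
- by rewrite /Inv subnn; split.
- move=> m' h' [_ _ [im' fm' hE] r]; split=> // v vn; apply: r; lia.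
Qed.

(** The cells that precede (i, j) lexicographically are filled. That the others are 0 is part of the
    claim because the TSP input must be reproduced exactly. *)
Definition copied i j m : Prop := forall a b, rmem m 8 a b =
  if [&& (a < i) || (a == i) && (b < j), a <= n & b <= n]%N
  then collapsed w marked (inord a) (inord b) else 0.

(** Real array 8 is left out because it is being written; natural array 8 gets the number of
    vertices only at the end. *)
Definition copying m : Prop :=
  [/\ inputs m, collapse_map m, forall x i, nmem m (x + 8) i = 0%N
    & forall x i j, rmem m (x.+1 + 8) i j = 0].

Lemma copying_setn m y i k : (y < 3)%N -> (0 < y)%N ->
  copying m -> copying (setn m y i k).
Proof.
move=> y3 y0 [[a1 a2 a3] b c e]; split=> //=.
- by case: y y3 y0 => [|[|[|]]].
- by case: y y3 y0 => [|[|[|]]].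
- by move=> x j; case: eqP => [?|_]; [exfalso; lia|exact: c].
Qed.

Lemma copying_setr8 m i j r : copying m -> copying (setr m 8 i j r).
Proof.
move=> [[a1 a2 a3] b c e]; split=> //= x k l.
by case: eqP => [?|_]; [exfalso; lia | exact: e].
Qed.

Lemma copy_body_correct i j m h : (i <= n)%N -> (j <= n)%N ->
  copying m -> copied i j m -> nmem m 1 0 = i -> nmem m 2 0 = j ->
  triple (duration (copy_body R)) (copy_body R) m h (fun m' h' =>
    [/\ copying m', copied i j.+1 m', nmem m' 1 0 = i, nmem m' 2 0 = j.+1
      & h' = h]).
Proof.
move=> i_n jn cm cp m1 m2; apply: triple_wp => /=; split=> //=.
- by apply: copying_setn => //; exact: copying_setr8.
- have [[_ W _] r _ _] := cm.
  move=> a b; rewrite /= m1 m2; case: (eqVneq a i) => [->|ai] /=; last first.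
    by rewrite cp (negbTE ai).
  case: (eqVneq b j) => [->|bj] /=.
    rewrite ltnn ltnSn i_n jn /= !r // W /weight_array !leq_ord.
    by rewrite !inord_val mxE.
  have -> : (b < j.+1)%N = (b < j)%N by rewrite ltnS leq_eqVlt (negbTE bj).
  by rewrite cp eqxx.
- by rewrite m2 addn1.
Qed.

Lemma copy_row_correct i m h : (i <= n)%N ->
  copying m -> copied i 0 m -> nmem m 1 0 = i ->
  triple (n.+1 * (duration (copy_body R)).+1 + 6) (copy_row R) m h (fun m' h' =>
    [/\ copying m', copied i.+1 0 m', nmem m' 1 0 = i.+1 & h' = h]).
Proof.
move=> i_n cm cp m1.
pose Inv k m' h' := [/\ (k <= n.+1)%N, copying m', copied i (n.+1 - k) m',
   (nmem m' 1 0 = i /\ nmem m' 2 0 = n.+1 - k)%N & h' = h].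
apply: (triple_weaken (T := (1 + ((n.+1 * (duration (copy_body R)).+1).+1 + 1).+1).+1));
  last 2 first.
- by lia.
- by move=> m' h'; apply.
apply: triple_seq; apply: triple_setn; apply: triple_seq.
apply: (triple_post (triple_while (Inv := Inv) (K := n.+1) _ _ _)).
- by move=> k m' h' [kn [[N0 _ _] _ _ _] _ [_ k1] _] /=; rewrite N0 k1; lia.
- move=> k m' h' [kn cm' cp' [m1' m2'] hE].
  apply: (triple_post (copy_body_correct h' i_n _ cm' cp' m1' m2')); first by lia.
  move=> m2 h2 [c2 p2 e1 e2 hh]; have E : (n.+1 - k = (n.+1 - k.+1).+1)%N by lia.
  by split; rewrite ?E //; [lia|rewrite hh].
- rewrite /Inv subnn; split=> //.
  + exact: copying_setn.
- move=> m' h' [_ cm' cp' [m1' m2'] hE]; apply: triple_setn; split=> //=.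
  + exact: copying_setn.
  + move=> a b; rewrite /= cp' subn0.
    by congr (if _ then _ else _); lia.
  + by rewrite m1' addn1.
Qed.

Lemma copy_correct m h : inputs m -> fresh_above m -> collapse_map m ->
  triple (n.+1 * (n.+1 * (duration (copy_body R)).+1 + 7) + 5) (copy R) m h
    (fun m' h' => [/\ inputs m', collapse_map m',
       embeds 8 (tsp_input (collapsed w marked)) m' & h' = h]).
Proof.
move=> im [fn fr] cm.
pose Inv k m' h' := [/\ (k <= n.+1)%N, copying m', copied (n.+1 - k) 0 m',
   (nmem m' 1 0 = n.+1 - k)%N & h' = h].
apply: (triple_weaken (T := (1 +
  ((n.+1 * (n.+1 * (duration (copy_body R)).+1 + 6).+1).+1 + 1).+1).+1));
  last 2 first.
- by lia.
- by move=> m' h'; apply.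
apply: triple_seq; apply: triple_setn; apply: triple_seq.
apply: (triple_post (triple_while (Inv := Inv) (K := n.+1) _ _ _)).
- by move=> k m' h' [kn [[N0 _ _] _ _ _] _ k1 _] /=; rewrite N0 k1; lia.
- move=> k m' h' [kn cm' cp' m1' hE].
  apply: (triple_post (copy_row_correct h' _ cm' cp' m1')); first by lia.
  move=> m2 h2 [c2 p2 e1 hh]; have E : (n.+1 - k = (n.+1 - k.+1).+1)%N by lia.
  by split; rewrite ?E //; [lia|rewrite hh].
- rewrite /Inv subnn; split=> //.
    by apply: copying_setn => //; split=> // x i j; rewrite fr.
  by move=> a b; rewrite /= andbF; exact: (fr 0%N).
- move=> m' h' [_ [im' r' n' rr'] cp' m1' hE]; apply: triple_setn; split=> //=.
  split=> /= [x i|x i j].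
    rewrite /tsp_nmem (_ : (x + 8 == 8)%N = (x == 0%N)); last by lia.
    have [N0 _ _] := im'.
    by case: ifP => _; rewrite ?N0 ?n'.
  case: x => [|x] /=; last by rewrite rr'.
  rewrite add0n cp' /weight_array subn0 andbF orbF ltnS.
  by case: (i <= n)%N.
Qed.

Variables (s : 'S_n.+1) (j0 : 'I_n.+1).
Hypothesis sj0 : s j0 = ord0.
Notation q := (fill_level alpha (capacity I) (cost_a I) (cost_b I)).

Definition ready m : Prop :=
  [/\ inputs m, collapse_map m, forall i : 'I_n.+1, nmem m 9 i = s i
    & rmem m 3 0 0 = q].

Lemma set_start_correct m h : inputs m -> collapse_map m ->
  (forall i : 'I_n.+1, nmem m 9 i = s i) ->
  triple (duration (set_start alpha)) (set_start alpha) m h (fun m' h' =>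
    [/\ ready m', rmem m' 4 0 0 = start_load q u,
        [/\ nmem m' 1 0 = 1, nmem m' 4 0 = 0 & nmem m' 5 0 = 0]%N
      & h' = rcons h (SetLoad n (start_load q u))]).
Proof.
move=> im cm tm; apply: triple_wp => /=; have [_ _ P] := im.
rewrite !P /=.
have rq m' : inputs m' -> collapse_map m' ->
  (forall i : 'I_n.+1, nmem m' 9 i = s i) -> rmem m' 3 0 0 = q -> ready m' by [].
have qE : q = if cost_b I * alpha * capacity I <= 2 * cost_a I
  then capacity I else 2 * cost_a I / (cost_b I * alpha) by [].
set qv := q in rq qE *; clearbody qv.
rewrite /start_load; case: ifP qE => _ qE /=; subst qv; rewrite ?P /=;
  (case: (u <= 0) => /=; rewrite ?P /=;
   [by split=> //; apply: rq | case: (1 <= u) => /=; rewrite ?P /=;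
     by split=> //; apply: rq]).
Qed.

(** The tour [s] is injective, so among its positions only [j0] holds the depot and the loop stops
    after exactly [j0] iterations. *)
Lemma find_depot_correct m h : ready m -> nmem m 4 0 = 0%N ->
  triple (n.+1 * 2).+1 (find_depot R) m h (fun m' h' =>
    [/\ ready m', rmem m' 4 0 0 = rmem m 4 0 0, nmem m' 1 0 = nmem m 1 0,
        nmem m' 5 0 = nmem m 5 0 & nmem m' 4 0 = j0 /\ h' = h]).
Proof.
move=> rm m4.
pose Inv k m' h' := [/\ (k <= j0)%N /\ ready m', rmem m' 4 0 0 = rmem m 4 0 0,
   nmem m' 1 0 = nmem m 1 0, nmem m' 5 0 = nmem m 5 0
   & nmem m' 4 0 = (j0 - k)%N /\ h' = h].
have jn := ltn_ord j0.
apply: (triple_weaken (T := (j0 * 2).+1) (post := Inv 0%N)); last 2 first.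
- by lia.
- by move=> m' h' [[_ r'] e1 e2 e3 [e4 e5]]; rewrite subn0 in e4; split.
apply: triple_while.
- move=> k m' h' [[kj [_ _ tm _]] _ _ _ [e4 _]] /=; rewrite e4.
  have jk : (j0 - k < n.+1)%N by lia.
  rewrite -[X in nmem m' 9 X](@inordK n) // tm lt0n.
  rewrite (_ : (s (inord (j0 - k)) == 0 :> nat)%N = (s (inord (j0 - k)) == s j0)).
    by rewrite (inj_eq perm_inj) -val_eqE /= inordK //; lia.
  by rewrite sj0.
- move=> k m' h' [[kj r'] e1 e2 e3 [e4 e5]].
  apply: (@triple_wp _ _ _ _ (CSetN _ _ _ _)) => /=; split=> //=.
  + by split=> //; exact: ltnW.
  + by rewrite e4; split=> //; lia.
- by split=> //; rewrite subnn.
Qed.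

Definition customers (vs : seq 'I_n.+1) : seq 'I_n :=
  pmap (unlift ord0) (seq.filter marked vs).

Lemma advance_correct a m h : ready m -> (a <= n)%N ->
  nmem m 4 0 = ((j0 + a) %% n.+1)%N ->
  triple (duration (advance R)) (advance R) m h (fun m' h' =>
    [/\ ready m', [/\ rmem m' 4 0 0 = rmem m 4 0 0, nmem m' 1 0 = nmem m 1 0
        & nmem m' 5 0 = nmem m 5 0], nmem m' 4 0 = ((j0 + a.+1) %% n.+1)%N,
        nmem m' 6 0 = collapse marked (tour_from s j0 a.+1) & h' = h]).
Proof.
move=> rm an m4; have [[N0 _ _] cm tm _] := rm.
have cn : ((j0 + a) %% n.+1 < n.+1)%N by rewrite ltn_mod.
have tE : nmem m 9 ((j0 + a.+1) %% n.+1)%N = tour_from s j0 a.+1.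
  by rewrite /tour_from -tm inordK // ltn_mod.
have cE : nmem m 3 (tour_from s j0 a.+1) = collapse marked (tour_from s j0 a.+1).
  by rewrite cm ?leq_ord // inord_val.
have E : ((j0 + a.+1) %% n.+1 = if n.+1 <= (j0 + a) %% n.+1 + 1
           then 0 else (j0 + a) %% n.+1 + 1)%N.
  rewrite addnS -addn1 -modnDml; have [c1|c1] := leqP n.+1 ((j0 + a) %% n.+1 + 1)%N;
    last by rewrite (modn_small c1).
  by rewrite (_ : (_ + 1 = n.+1)%N) ?modnn //; lia.
apply: triple_wp => /=; rewrite N0 m4; case: ifP E => _ E /=;
  by rewrite E in tE *; split => //=; rewrite tE cE.
Qed.

Lemma visit_correct i L m h : ready m -> nmem m 6 0 = lift ord0 i ->
  rmem m 4 0 0 = L ->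
  triple (duration (visit_code R)) (visit_code R) m h (fun m' h' =>
    [/\ ready m', rmem m' 4 0 0 = next_load q d L i,
        nmem m' 5 0 = lift ord0 i :> nat,
        nmem m' 1 0 = nmem m 1 0 /\ nmem m' 4 0 = nmem m 4 0
      & h' = h ++ visit q d L i]).
Proof.
move=> rm m6 m4; have [_ _ _ m3] := rm; apply: triple_wp => /=.
have dE : at_vertex 0 d (inord (nmem m 6 0)) = d i.
  by rewrite m6 inord_val /at_vertex liftK.
have vE : inord (nmem m 6 0) = lift ord0 i by rewrite m6 inord_val.
have o0 : inord 0 = ord0 :> 'I_n.+1 by apply: val_inj; rewrite /= inordK.
rewrite dE vE m4 /next_load /visit /refill; case: ifP => dL /=.
  by split=> //=; rewrite ?dL ?m4 // -?cats1 -?catA.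
rewrite ?dE m3; case: ifP => qd /=; split=> //=;
  rewrite ?dL ?m3 ?m4 ?dE // ?vE ?o0 -?cats1 -?catA ?maxEle ?qd //=.
Qed.

Lemma customers_cons v vs : customers (v :: vs) =
  if marked v then (if unlift ord0 v is Some i then i :: customers vs
                    else customers vs) else customers vs.
Proof. by rewrite /customers /=; case: ifP => //= _; case: (unlift ord0 v). Qed.

Notation tour_customers b k := (customers [seq tour_from s j0 a | a <- iota b k]).

(** The invariant: the actions emitted so far, followed by the route still to be driven from the
    current position and load, form the same itinerary throughout. After this iteration [k] more
    remain. *)
Lemma drive_body_correct k p L m h : ready m -> (k < n)%N ->
  nmem m 1 0 = (n.+1 - k.+1)%N -> nmem m 4 0 = ((j0 + (n - k.+1)) %% n.+1)%N ->
  nmem m 5 0 = nat_of_ord (p : 'I_n.+1) -> rmem m 4 0 0 = L ->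
  triple (duration (drive_body R)) (drive_body R) m h (fun m' h' =>
    [/\ ready m', nmem m' 1 0 = (n.+1 - k)%N,
        nmem m' 4 0 = ((j0 + (n - k)) %% n.+1)%N
      & exists (p' : 'I_n.+1) L', [/\ nmem m' 5 0 = p', rmem m' 4 0 0 = L' &
          h' ++ route q d p' L' (tour_customers (n - k).+1 k) =
          h ++ route q d p L (tour_customers (n - k.+1).+1 k.+1)]]).
Proof.
move=> rm kn m1 m4 m5 mL.
have kE : (n - k = (n - k.+1).+1)%N by lia.
apply: (@triple_weaken _ _ _ _ (duration (advance R) +
  ((duration (visit_code R)).+1 + 1).+1).+1) => //; last by move=> m' h'; apply.
apply: triple_seq.
apply: (triple_post (@advance_correct (n - k.+1) m h rm _ m4)); first by lia.
move=> m2 h2 [r2 [e4 e1 e5] e4' e6 hh].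
rewrite -kE in e4' e6.
apply: triple_seq; apply: triple_if => /=.
have fin m' h' (p' : 'I_n.+1) L' : ready m' -> nmem m' 1 0 = (n.+1 - k.+1)%N ->
    nmem m' 4 0 = ((j0 + (n - k)) %% n.+1)%N -> nmem m' 5 0 = p' ->
    rmem m' 4 0 0 = L' ->
    h' ++ route q d p' L' (tour_customers (n - k).+1 k) =
      h ++ route q d p L (tour_customers (n - k.+1).+1 k.+1) ->
    triple 1 (CSetN R 1 (NConst 0) (NAdd (NGet 1 (NConst 0)) (NConst 1))) m' h'
    (fun m' h' => [/\ ready m', nmem m' 1 0 = (n.+1 - k)%N,
        nmem m' 4 0 = ((j0 + (n - k)) %% n.+1)%N
      & exists (p' : 'I_n.+1) L', [/\ nmem m' 5 0 = p', rmem m' 4 0 0 = L' &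
          h' ++ route q d p' L' (tour_customers (n - k).+1 k) =
          h ++ route q d p L (tour_customers (n - k.+1).+1 k.+1)]]).
  move=> r' f1 f4 f5 fL fh; apply: triple_setn; split=> //=.
    by rewrite f1; lia.
  by exists p', L'.
have cE : tour_customers (n - k.+1).+1 k.+1 =
    customers (tour_from s j0 (n - k) :: [seq tour_from s j0 a | a <- iota (n - k).+1 k]).
  by rewrite kE.
rewrite e6 /collapse; case: (boolP (marked _)) => mk.
  have [i iE] : exists i, tour_from s j0 (n - k) = lift ord0 i.
    have /andP[v0 _] := mk; rewrite eq_sym in v0.
    by have [i iE _] := unlift_some v0; exists i.
  rewrite iE /= ; apply: (triple_post (visit_correct (i := i) h2 r2 _ erefl)).
    by rewrite e6 /collapse mk iE.
  move=> m' h' [r' f4 f5 [f1 f4'] fh].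
  apply: (fin m' h' (lift ord0 i) (next_load q d L i)) => //.
  - by rewrite f1 e1.
  - by rewrite f4'.
  - by rewrite f4 e4 mL.
  by rewrite cE customers_cons mk iE liftK /= fh hh e4 mL catA.
apply: (triple_weaken (T := 1) (post := fun m' h' => m' = m2 /\ h' = h2)) => //.
  by apply: triple_skip.
move=> m' h' [-> ->]; apply: (fin m2 h2 p L) => //.
- by rewrite e1.
- by rewrite e5.
- by rewrite e4.
by rewrite cE customers_cons (negbTE mk) hh.
Qed.

Lemma drive_correct L m h : ready m -> nmem m 1 0 = 1%N -> nmem m 4 0 = j0 ->
  nmem m 5 0 = 0%N -> rmem m 4 0 0 = L ->
  triple (n * (duration (drive_body R)).+1 + 4) (drive R) m h (fun m' h' =>
    h' = h ++ route q d ord0 L (tour_customers 1 n)).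
Proof.
move=> rm m1 m4 m5 mL.
pose Inv k m' h' := [/\ (k <= n)%N /\ ready m', nmem m' 1 0 = (n.+1 - k)%N,
   nmem m' 4 0 = ((j0 + (n - k)) %% n.+1)%N
   & exists (p : 'I_n.+1) L', [/\ nmem m' 5 0 = p, rmem m' 4 0 0 = L' &
       h' ++ route q d p L' (tour_customers (n - k).+1 k) =
       h ++ route q d ord0 L (tour_customers 1 n)]].
apply: (@triple_weaken _ _ _ _ ((n * (duration (drive_body R)).+1).+1 + 2).+1);
  [|by lia|by move=> m' h'; apply].
apply: triple_seq.
apply: (triple_post (triple_while (Inv := Inv) (K := n) _ _ _)).
- by move=> k m' h' [[kn [[N0 _ _] _ _ _]] k1 _ _] /=; rewrite N0 k1; lia.
- move=> k m' h' [[kn rm'] e1 e4 [p [L' [e5 eL hE]]]].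
  apply: (triple_post (drive_body_correct h' rm' kn e1 e4 e5 eL)).
  move=> m2 h2 [r2 f1 f4 [p2 [L2 [f5 fL fh]]]]; split=> //; first by split=> //; lia.
  by exists p2, L2; split=> //; rewrite fh.
- split=> //; rewrite ?m1 ?m4 ?subnn ?addn0.
  + by lia.
  + by rewrite modn_small.
  + by exists ord0, L.
- move=> m' h' [[_ r'] _ _ [p [L' [e5 eL hE]]]]; apply: triple_if => /=.
  rewrite e5 lt0n (_ : (p == 0 :> nat)%N = (p == ord0)) //.
  move: hE; rewrite /customers /=; case: ifP => p0 <-.
    by apply: triple_skip; rewrite cats0.
  apply: triple_go => /=; rewrite -cats1; congr (_ ++ [:: Go _ _]).
  by apply: val_inj; rewrite /= inordK.
Qed.

Variable T : nat.
Let g := run (n := n) (fun _ _ => 0) (fun=> 0) T ctsp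
           (tsp_input (collapsed w marked)).
Hypotheses (offline_tsp : offline ctsp) (halted_tsp : halted g).
Hypothesis tsp_output : forall i : 'I_n.+1, nmem g.1.2 1 i = s i.

Lemma vrp_program_correct :
  triple (T + 1000 * (n.+1 * n.+1)) (vrp_program alpha ctsp) (vrp_input I u) [::]
    (fun _ h => h = SetLoad n (start_load q u) ::
                    route q d ord0 (start_load q u) (tour_customers 1 n)).
Proof.
have im : inputs (vrp_input I u) by split.
have fm : fresh_above (vrp_input I u).
  by split=> [x i|x i j] /=; rewrite !addnS.
pose T1 := (n.+1 * (duration (mark_body R)).+1).+1.
pose T2 := (n.+1 * (n.+1 * (duration (copy_body R)).+1 + 7) + 5)%N.
pose T4 := duration (set_start alpha).
pose T5 := (n.+1 * 2).+1.
pose T6 := (n * (duration (drive_body R)).+1 + 4)%N.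
apply: (@triple_weaken _ _ _ _
  (T1 + (T2 + (T + (T4 + (T5 + T6).+1).+1).+1).+1).+1);
  last 2 first.
(* Copying the matrix is quadratic and the other phases around the TSP program are at most linear;
   1000 is a generous common constant. *)
- rewrite /T1 /T2 /T4 /T5 /T6 /=; nia.
- by move=> m h; apply.
apply: triple_seq; apply: (triple_post (mark_correct _ im fm _)) => //.
move=> m1 h1 [im1 fm1 cm1 hE1].
apply: triple_seq; apply: (triple_post (copy_correct _ im1 fm1 cm1)).
move=> m2 h2 [im2 cm2 em2 hE2].
apply: triple_seq; apply: (triple_post (triple_shift _ _ _ offline_tsp em2 halted_tsp)).
move=> m3 h3 [em3 [sn sr] hE3].
have im3 : inputs m3.
  by have [a b c] := im2; split=> *; rewrite ?sn ?sr.
have cm3 : collapse_map m3 by move=> v vn; rewrite sn // cm2.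
have tm3 (i : 'I_n.+1) : nmem m3 9 i = s i.
  by have [en _] := em3; rewrite -tsp_output en.
apply: triple_seq; apply: (triple_post (set_start_correct h3 im3 cm3 tm3)).
move=> m4 h4 [r4 L4 [i4 c4 p4] hE4].
apply: triple_seq; apply: (triple_post (find_depot_correct h4 r4 c4)).
move=> m5 h5 [r5 L5 i5 p5 [c5 hE5]].
apply: (triple_post (drive_correct (L := start_load q u) h5 r5 _ c5 _ _)).
- by rewrite i5.
- by rewrite p5.
- by rewrite L5.
by move=> m6 h6 ->; rewrite hE5 hE4 hE3 hE2 hE1.
Qed.

End Verification.

(** * The choice of the fill level and the ratio it gives *)

Section FillLevel.
Variables (R : realType) (alpha Q a b : R).
Hypotheses (alpha1 : 1 <= alpha) (Q0 : 0 < Q) (a0 : 0 <= a) (b0 : 0 <= b).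
Notation q := (fill_level alpha Q a b).

Lemma fill_level_range : 0 <= q <= Q.
Proof.
have := a0; rewrite /fill_level => a0'; case: (lerP (b * alpha * Q)) => h; first by rewrite lexx ltW.
have ba0 : 0 < b * alpha.
  have al0 : 0 <= alpha by rewrite (le_trans ler01).
  rewrite lt_neqAle mulr_ge0 // andbT eq_sym.
  by apply/eqP => E; move: h; rewrite E mul0r; lra.
apply/andP; split; first by apply: divr_ge0; [lra | exact: ltW].
by rewrite ler_pdivrMr // (mulrC Q) ltW.
Qed.

Lemma start_load_range u : 0 <= start_load q u <= q.
Proof.
have /andP[q0 _] := fill_level_range; rewrite /start_load.
case: (lerP u 0) => u0; first by rewrite lexx.
case: (lerP 1 u) => u1; first by rewrite lexx andbT.
apply/andP; split; first by rewrite mulr_ge0 // ltW.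
by rewrite ler_piMr // ltW.
Qed.

Lemma start_load_rotation u : 0 <= u <= 1 -> start_load q u = q * rotation 0 u.
Proof.
move=> /andP[u0 u1]; rewrite /start_load /rotation ltNge u0 /= subr0 addr0.
case: (lerP u 0) => h; first by rewrite (_ : u = 0) ?mulr0 //; lra.
by case: (lerP 1 u) => // h1; rewrite (_ : u = 1) ?mulr1 //; lra.
Qed.

(* If q = Q, the bound is the combination of the two lower bounds with weights
   alpha (1 + g) and 1 - alpha g, where g = b Q / (2 a); otherwise it is
   alpha + 1 times the first one. *)
Lemma fill_level_ratio (t S : R) : 0 <= t -> 0 <= S ->
  exists2 kappa, 0 <= kappa /\ 2 * a <= kappa * q &
    (a + b * (q / 2)) * (alpha * t) + (kappa + b) * S <=
    (alpha + 1) * Num.max (a * t + b * S) ((2 * a / Q + b) * S).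
Proof.
have [al1 a0'] := (alpha1, a0); move=> t0 S0; set M := Num.max _ _.
have M1 : a * t + b * S <= M by rewrite le_max lexx.
have M2 : (2 * a / Q + b) * S <= M by rewrite le_max lexx orbT.
clearbody M; rewrite /fill_level; case: (lerP (b * alpha * Q)) => h; last first.
  have ba0 : 0 < b * alpha.
    have al0 : 0 <= alpha by rewrite (le_trans ler01).
  rewrite lt_neqAle mulr_ge0 // andbT eq_sym.
    by apply/eqP => E; move: h; rewrite E mul0r; lra.
  have bn0 : b != 0 by apply/eqP => E; move: ba0; rewrite E mul0r ltxx.
  (* Here b q / 2 = a / alpha, so this [kappa], with kappa q = 2 a, turns the left side into exactly
     alpha + 1 times a t + b S. *)
  exists (b * alpha); first by split; [exact: ltW | rewrite (mulrC (b * alpha)) divfK // gt_eqF].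
  rewrite (_ : _ + _ = (alpha + 1) * (a * t + b * S)); last first.
    have an0 : alpha != 0 by rewrite gt_eqF //; lra.
    by field; rewrite an0 bn0.
  by rewrite ler_wpM2l //; lra.
have QV : Q * Q^-1 = 1 by rewrite mulfV // gt_eqF.
exists (2 * a / Q).
  split; first by rewrite divr_ge0 ?mulr_ge0 // ltW.
  by rewrite divfK // gt_eqF.
(* The weight [g] divides by 2 a. If [a = 0], the case hypothesis forces [b = 0] and the left side
   vanishes. *)
have [az|an0] := eqVneq a 0.
  have bz : b = 0.
    apply/eqP; rewrite eq_le b0 andbT leNgt; apply/negP => bp.
    have : 0 < b * alpha * Q by rewrite !mulr_gt0 //; lra.
    by move: h; rewrite az; lra.
  by move: M1; rewrite az bz !(mul0r, mulr0, addr0); move=> M0; rewrite mulr_ge0 //; lra.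
have ap : 0 < a by rewrite lt_neqAle eq_sym an0.
pose g := b * Q / (2 * a).
have g0 : 0 <= g by rewrite divr_ge0 // mulr_ge0 // ltW.
have ag1 : alpha * g <= 1.
  rewrite /g mulrA ler_pdivrMr; last by lra.
  by rewrite mul1r mulrA (mulrC alpha).
have -> : (a + b * (Q / 2)) * (alpha * t) + (2 * a / Q + b) * S =
  (alpha * (1 + g)) * (a * t + b * S) + (1 - alpha * g) * ((2 * a / Q + b) * S).
  by rewrite /g; field; rewrite an0 gt_eqF.
have -> : (alpha + 1) * M = (alpha * (1 + g)) * M + (1 - alpha * g) * M by ring.
by apply: lerD; apply: ler_wpM2l => //; [rewrite mulr_ge0 //; lra | lra].
Qed.

End FillLevel.

(** * The algorithm on one instance: order of visits, validity, cost *)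

Section Tour.
Variables (R : realType) (I : instance R).
Notation n := (ncust I).
Notation vertex := (lift (ord0 : 'I_n.+1)).

Definition demand_cdf (i : 'I_n) (r : R) : R := fine (cdf (demand I i) r).

Notation ess := (marked demand_cdf).

Lemma marked_vertex i : ess (vertex i) = essential i.
Proof. by rewrite /marked /essential /at_vertex liftK eq_sym neq_lift /= ltNge. Qed.

Lemma map_customers vs : map vertex (customers demand_cdf vs) = seq.filter ess vs.
Proof.
elim: vs => //= v vs IH; rewrite customers_cons; case: ifP => // mv.
have /andP[v0 _] := mv; rewrite eq_sym in v0.
by have [i -> _] := unlift_some v0; rewrite liftK /= IH.
Qed.

Variables (s : 'S_n.+1) (j0 : 'I_n.+1).
Hypothesis sj0 : s j0 = ord0.

Definition tour_order : seq 'I_n :=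
  customers demand_cdf [seq tour_from s j0 a | a <- iota 1 n].

Lemma uniq_tour_order : uniq tour_order.
Proof.
rewrite -(map_inj_uniq (@lift_inj _ ord0)) map_customers filter_uniq //.
by rewrite map_inj_in_uniq ?iota_uniq //; exact: tour_from_inj.
Qed.

(** The depot and the [n] stops after it are [n.+1] distinct vertices, hence all of them; the filter
    then keeps the essential ones. *)
Lemma mem_tour_order i : (i \in tour_order) = essential i.
Proof.
rewrite -(mem_map (@lift_inj _ ord0)) map_customers mem_filter marked_vertex.
case: (essential i) => //=.
set l := map _ _.
have ul : uniq (ord0 :: l).
  rewrite /= map_inj_in_uniq ?iota_uniq ?andbT; last exact: tour_from_inj.
  apply/mapP => -[a ha] /esym/eqP; rewrite -sj0.
  exact/negP/tour_from_neq.
have := @subset_cardP _ (mem (ord0 :: l)) (mem 'I_n.+1).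
rewrite (card_uniqP ul) card_ord /= size_map size_iota => /(_ erefl).
rewrite subset_predT => /(_ isT) /(_ (vertex i)) /=.
by rewrite !inE eq_sym (negbTE (neq_lift _ _)).
Qed.

End Tour.

(** Every sample gives a demand in [0, Q], so a value outside has a ball around it that no sample
    hits, and such a ball has probability 0. *)
Lemma possible_range (R : realType) (I : instance R) (d : 'I_(ncust I) -> R) i :
  possible d -> 0 <= d i <= capacity I.
Proof.
move=> pd.
suff H (e : R) : 0 < e -> exists t, `|d i - demand I i t| < e.
  apply/andP; split; rewrite leNgt; apply/negP => lt.
    have [|t] := H (- d i); first by rewrite oppr_gt0.
    have /andP[t0 _] := demand_range i t.
    by rewrite ltr_norml => /andP[]; lra.
  have [|t] := H (d i - capacity I); first by rewrite subr_gt0.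
  have /andP[_ tQ] := demand_range i t.
  by rewrite ltr_norml => /andP[]; lra.
move=> e0; have := pd i e e0; apply: contraPP => /forallNP nt.
rewrite (_ : _ @^-1` _ = set0) ?measure0 ?ltxx //.
by apply/seteqP; split=> // t /nt.
Qed.

Section Algorithm.
Variables (R : realType) (alpha : R) (I : instance R) (s : 'S_(ncust I).+1).
Variable j0 : 'I_(ncust I).+1.
Hypotheses (alpha1 : 1 <= alpha) (sj0 : s j0 = ord0).
Notation n := (ncust I).
Notation w := (weight I).
Notation Q := (capacity I).
Notation vertex := (lift (ord0 : 'I_n.+1)).
Notation q := (fill_level alpha Q (cost_a I) (cost_b I)).
Notation w' := (collapsed w (marked (@demand_cdf R I))).
Notation vs := (tour_order s j0).
Hypothesis s_approx : tour_length w' s <= alpha * tsp_opt w'.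

Definition tour_outcome : outcome I := fun u d =>
  SetLoad n (start_load q u) :: route q d ord0 (start_load q u) vs.

Let q0Q : 0 <= q <= Q.
Proof.
by apply: fill_level_range; rewrite ?capacity_gt0 ?cost_a_ge0 ?cost_b_ge0.
Qed.

Let Lq u : 0 <= start_load q u <= q.
Proof.
by apply: start_load_range; rewrite ?capacity_gt0 ?cost_a_ge0 ?cost_b_ge0.
Qed.

Let wM := weight_metric I.

(** Customers off the route are inessential, so in a possible demand vector they ask for nothing. *)
Lemma tour_outcome_valid u d : possible d -> valid d (tour_outcome u d).
Proof.
move=> pd; have dQ i := possible_range i pd.
have [|lg ps dl] := route_valid q0Q (p := ord0) (vs := vs) (fun=> 0) dQ (Lq u)
  (uniq_tour_order s j0).
  by apply/mapP => -[i _ /eqP]; rewrite (negbTE (neq_lift _ _)).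
have /andP[L0 L1] := Lq u; have /andP[_ qQ] := q0Q.
split=> //=; first by rewrite L0 (le_trans L1 qQ) /=.
move=> i; rewrite dl add0r mem_tour_order //.
by case: ifPn => // /inessential_demand0 ->.
Qed.

Lemma tour_outcome_cost z : realized_cost tour_outcome z =
  route_cost q (fun i => demand I i z.1) ord0 (start_load q z.2) vs.
Proof. by rewrite /realized_cost /cumulative_cost /= add0r route_costE. Qed.

Lemma measurable_tour_outcome :
  measurable_fun [set: sample I * R] (realized_cost tour_outcome).
Proof.
rewrite (_ : realized_cost _ = fun z => route_cost q (fun i => demand I i z.1)
  ord0 (start_load q z.2) vs); last by apply/funext => z; exact: tour_outcome_cost.
apply: measurable_route_cost; rewrite /start_load.
have m2 : measurable_fun [set: sample I * R] (@snd (sample I) R).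
  exact: measurable_snd.
apply: measurable_fun_ifT => //; first exact: measurable_fun_ler.
apply: measurable_fun_ifT => //; first exact: measurable_fun_ler.
exact: measurable_funM.
Qed.

Lemma tour_outcome_expected_cost_le kappa : 0 <= kappa ->
  2 * cost_a I <= kappa * q ->
  (expected_cost tour_outcome <=
   ((cost_a I + cost_b I * (q / 2)) * (alpha * tsp_opt w') +
    (kappa + cost_b I) * mean_service I)%:E)%E.
Proof.
move=> k0 kq; have a0 := cost_a_ge0 I; have b0 := cost_b_ge0 I.
rewrite -integral_affine_service; apply: expected_cost_le_mean.
- exact: measurable_tour_outcome.
- apply: measurable_funD => //; apply: measurable_funM => //.
  exact: measurable_service.
- move=> z; rewrite tour_outcome_cost; apply: route_cost_ge0 => // i.
  by have /andP[] := demand_range i z.1.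
move=> t; have d0 i : 0 <= demand I i t by have /andP[] := demand_range i t.
have c01 : 0 <= (0 : R) <= 1 by rewrite lexx ler01.
have [g gle gm] := route_cost_mean_le q0Q k0 kq ord0 vs d0 c01.
set m := (X in has_mean g X) in gm.
pose m' := (cost_a I + cost_b I * (q / 2)) * (alpha * tsp_opt w') +
  (kappa + cost_b I) * service (fun i => demand I i t).
(* The bound [m'] replaces the route length by alpha times the optimum and the sum over the route by
   the full service; the constant slack [m' - m] lifts the mean of [g] to it. *)
exists (fun u => g u + (m' - m)); last first.
  by apply: eq_has_mean (has_meanD gm (has_mean_cst (m' - m))) => //; rewrite addrC subrK.
move=> u u01; rewrite tour_outcome_cost /= start_load_rotation //.
rewrite -[leLHS]addr0 lerD ?gle // subr_ge0 /m /m'; apply: lerD.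
  apply: ler_wpM2l; first by rewrite addr_ge0 ?mulr_ge0 //; case/andP: q0Q.
  apply: le_trans s_approx; rewrite map_customers.
  exact: filter_tour_le.
apply: ler_wpM2l; first by rewrite addr_ge0.
have [w0 _ _ _] := wM.
rewrite big_uniq ?uniq_tour_order //= /service [leRHS](bigID (mem vs)) /=.
by rewrite lerDl; apply: sumr_ge0 => i _; rewrite mulr_ge0.
Qed.

(** A valid itinerary costs at least a times its length plus b S. The length is at least the tour
    optimum, because every essential customer is visited, and at least 2 S / Q. *)
Lemma admissible_expected_cost_ge (pi : policy I) : admissible pi ->
  ((Num.max (cost_a I * tsp_opt w' + cost_b I * mean_service I)
      ((2 * cost_a I / Q + cost_b I) * mean_service I))%:E <=
   expected_cost (policy_outcome pi))%E.
Proof.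
move=> adm; have [ad mpi] := adm.
have a0 := cost_a_ge0 I; have b0 := cost_b_ge0 I; have Q0 := capacity_gt0 I.
have T0 : 0 <= tsp_opt w' by apply: tsp_opt_ge0; exact: collapsed_metric.
have outV t u : possible (fun i => demand I i t) -> 0 <= u <= 1 ->
    valid (fun i => demand I i t) (policy_outcome pi u (fun i => demand I i t)).
  by move=> pd u01; have [h [fh vh]] := ad _ _ u01 pd; rewrite (policy_outcomeE fh).
have LB1 : ((cost_a I * tsp_opt w' + cost_b I * mean_service I)%:E <=
    expected_cost (policy_outcome pi))%E.
  rewrite -integral_affine_service; apply: integral_fst_le_expected_cost => //.
  - apply: measurable_funD => //; apply: measurable_funM => //.
    exact: measurable_service.
  - by move=> t; rewrite addr_ge0 // mulr_ge0 // service_ge0.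
  move=> t u pd u01; have vh := outV t u pd u01.
  apply: (le_trans _ (valid_cost_ge vh)); rewrite lerD2r ler_wpM2l //.
  apply: tsp_opt_le_closed_walk => //; first exact: valid_closed vh.
  move=> v mv; rewrite mem_walk; have /andP[v0 _] := mv; rewrite eq_sym in v0.
  have [i vE _] := unlift_some v0; rewrite vE marked_vertex in mv *.
  have [x x0 xs] := essential_support mv.
  exact: (admissible_visits adm u01 pd x0 xs).
have LB2 : (((2 * cost_a I / Q + cost_b I) * mean_service I)%:E <=
    expected_cost (policy_outcome pi))%E.
  rewrite -[X in X%:E]add0r -integral_affine_service.
  have c0 : 0 <= 2 * cost_a I / Q + cost_b I.
    by rewrite addr_ge0 // divr_ge0 ?mulr_ge0 // ltW.
  apply: integral_fst_le_expected_cost => //.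
  - apply: measurable_funD => //; apply: measurable_funM => //.
    exact: measurable_service.
  - by move=> t; rewrite add0r mulr_ge0 // service_ge0.
  move=> t u pd u01; have vh := outV t u pd u01.
  apply: (le_trans _ (valid_cost_ge vh)); rewrite add0r mulrDl lerD2r.
  rewrite (_ : 2 * cost_a I / Q = cost_a I * (2 / Q)); last by ring.
  by rewrite -mulrA ler_wpM2l // valid_pathlen.
by rewrite EFin_max ge_max LB1 LB2.
Qed.

Lemma tour_outcome_approx :
  (expected_cost tour_outcome <= (alpha + 1)%:E * opt_cost I)%E.
Proof.
have T0 : 0 <= tsp_opt w' by apply: tsp_opt_ge0; exact: collapsed_metric.
have [kappa [k0 kq] ratio] := fill_level_ratio alpha1 (capacity_gt0 I)
  (cost_a_ge0 I) (cost_b_ge0 I) T0 (mean_service_ge0 I).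
apply: (le_trans (tour_outcome_expected_cost_le k0 kq)).
have al0 : 0 < alpha + 1 by rewrite ltr_wpDl // (le_trans ler01).
apply: (@le_trans _ _ ((alpha + 1)%:E * (Num.max
  (cost_a I * tsp_opt w' + cost_b I * mean_service I)
  ((2 * cost_a I / Q + cost_b I) * mean_service I))%:E)%E).
  by rewrite -EFinM lee_fin.
apply: lee_wpmul2l; first by rewrite lee_fin ltW.
apply: le_ereal_inf_tmp => _ [pi adm <-]; exact: admissible_expected_cost_ge.
Qed.

End Algorithm.

Theorem theorem9 (R : realType) (alpha : R) :
  (exists c : com R, tsp_approximation alpha c) ->
  exists c : com R, cuvrpsd_approximation (alpha + 1) c.
Proof.
move=> [c ctsp]; have alpha1 := tsp_approximation_ge1 ctsp.
have [oc [p tspP]] := ctsp.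
(* The time of the TSP program on [(ncust I).+1] vertices plus a quadratic overhead. *)
exists (vrp_program alpha c), (p + (1000 : nat)%:P * 'X * 'X) => I t.
have tE : t = (p.[(ncust I).+1] + 1000 * ((ncust I).+1 * (ncust I).+1))%N.
  by rewrite /t hornerD !hornerMX hornerC -mulrA.
have wM := collapsed_metric (marked (@demand_cdf R I)) (weight_metric I).
have [hg [s [sout sle]]] := tspP _ _ wM.
pose j0 := (s^-1)%g ord0.
have sj0 : s j0 = ord0 by rewrite permKV.
have runP u d := triple_run
  (@vrp_program_correct R alpha c I u (@demand_cdf R I) d s j0 sj0 _ oc hg sout).
(* The tour depends only on weights and distributions, so one permutation [s] serves all seeds and
   demands. *)
have outE : vrp_outcome (vrp_program alpha c) t (I := I) = tour_outcome alpha s j0.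
  apply/funext => u; apply/funext => d.
  by rewrite /vrp_outcome /vrp_run tE; have [_ ->] := runP u d.
split.
- move=> u d u01 pd; rewrite outE; split; last exact: tour_outcome_valid.
  by rewrite /vrp_run tE; have [] := runP u d.
- by rewrite outE; exact: measurable_tour_outcome.
- by rewrite outE; exact: tour_outcome_approx.
Qed.
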